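(* Let $i\in\mathbb{N}_0$ and let $\alpha,\beta,\epsilon\in\mathbb{C}$. Then $$F^{0:2;2}_{1:0;0}\left[\begin{matrix}-: & \alpha,\ \epsilon\,; & \beta-\epsilon,\ 1-\alpha-\beta+\epsilon+i\,;\\ \beta: & -\,; & -\,;\end{matrix}\ -1,\ \tfrac12\right] =\frac{2^{\epsilon-\alpha-\beta+i}\,\Gamma(\beta-\epsilon-i)\,\Gamma(\beta)}{\Gamma(\epsilon)\,\Gamma(\beta-\epsilon)}\sum_{r=0}^{i}(-1)^r\binom{i}{r}\frac{\Gamma\!\left(\frac{\epsilon+r}{2}\right)}{\Gamma\!\left(\beta-i+\frac{r-\epsilon}{2}\right)}$$ and $$F^{0:2;2}_{1:0;0}\left[\begin{matrix}-: & \alpha,\ \epsilon\,; & \beta-\epsilon,\ 1-\alpha-\beta+\epsilon-i\,;\\ \beta: & -\,; & -\,;\end{matrix}\ -1,\ \tfrac12\right] =\frac{2^{\epsilon-\alpha-\beta-i}\,\Gamma(\beta)}{\Gamma(\epsilon)}\sum_{r=0}^{i}\binom{i}{r}\frac{\Gamma\!\left(\frac{\epsilon+r}{2}\right)}{\Gamma\!\left(\beta+\frac{r-\epsilon}{2}\right)}.$$ (The left-hand sides are Appell $F_3$ series.)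
   Context: For $\lambda\in\mathbb{C}$ and $n\in\mathbb{N}_0$, $(\lambda)_0=1$ and $(\lambda)_n=\lambda(\lambda+1)\cdots(\lambda+n-1)$; $\Gamma$ is Euler's Gamma function and $\binom{i}{r}$ the binomial coefficient. The (generalized) Kampé de Fériet function is defined by $$F^{H:A;B}_{G:C;D}\left[\begin{matrix}(h_H): & (a_A)\,; & (b_B)\,;\\ (g_G): & (c_C)\,; & (d_D)\,;\end{matrix}\ x,\ y\right]=\sum_{m=0}^\infty\sum_{n=0}^\infty\frac{\prod_{j=1}^H(h_j)_{m+n}\prod_{j=1}^A(a_j)_m\prod_{j=1}^B(b_j)_n}{\prod_{j=1}^G(g_j)_{m+n}\prod_{j=1}^C(c_j)_m\prod_{j=1}^D(d_j)_n}\frac{x^m}{m!}\frac{y^n}{n!},$$ where a dash ''$-$'' denotes an empty list of parameters (empty products equal $1$). In particular $F^{0:2;2}_{1:0;0}[-:\alpha,\epsilon;\beta-\epsilon,\gamma;\ \beta:-;-;\ x,y]=\sum_{m,n\ge0}\frac{(\alpha)_m(\epsilon)_m(\beta-\epsilon)_n(\gamma)_n}{(\beta)_{m+n}}\frac{x^my^n}{m!\,n!}$ (Appell's $F_3$). Parameters are tacitly assumed to be such that the double series converges, no denominator parameter is a non-positive integer, and all Gamma values appearing are finite. *)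

(* Defs.v *)
From Stdlib Require Import Reals Arith Factorial.
From Coquelicot Require Import Coquelicot.

Open Scope C_scope.

Fixpoint poch (a : C) (n : nat) : C :=
  match n with
  | O => 1
  | S k => poch a k * (a + RtoC (INR k))
  end.

Fixpoint cpown (z : C) (n : nat) : C :=
  match n with
  | O => 1
  | S k => cpown z k * z
  end.

(** Complex power a^z of a positive real base a, principal branch:
    a^z = exp (z ln a). *)
Definition cpowR (a : R) (z : C) : C :=
  RtoC (exp (Re z * ln a)) * (cos (Im z * ln a), sin (Im z * ln a)).

(** Euler's Gamma function, via Euler's (Gauss') limit formula
    Gamma z = lim_{n -> oo} n! n^z / (z (z+1) ... (z+n)),
    valid for every complex z that is not a non-positive integer. *)
Definition Gamma_seq (z : C) (n : nat) : C :=
  RtoC (INR (fact n)) * cpowR (INR n) z / poch z (S n).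

Definition Gamma (z : C) : C :=
  @lim C_CompleteNormedModule (filtermap (Gamma_seq z) eventually).

Definition not_npint (z : C) : Prop := forall k : nat, z <> - RtoC (INR k).

Fixpoint binom (n k : nat) : nat :=
  match n, k with
  | _, O => 1%nat
  | O, S _ => 0%nat
  | S n', S k' => (binom n' k' + binom n' k)%nat
  end.

Fixpoint csum (i : nat) (f : nat -> C) : C :=
  match i with
  | O => f O
  | S k => csum k f + f (S k)
  end.

(** General term of F^{0:2;2}_{1:0;0}[-: a1,a2; b1,b2; g: -; -; x, y]
    (Appell F3):  (a1)_m (a2)_m (b1)_n (b2)_n / (g)_{m+n} x^m/m! y^n/n!. *)
Definition F3_term (a1 a2 b1 b2 g x y : C) (m n : nat) : C :=
  poch a1 m * poch a2 m * poch b1 n * poch b2 n / poch g (m + n)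
  * cpown x m / RtoC (INR (fact m)) * cpown y n / RtoC (INR (fact n)).

Definition dseries_converges (t : nat -> nat -> C) : Prop :=
  (forall m, ex_series (t m)) /\
  (forall S : nat -> C, (forall m, is_series (t m) (S m)) -> ex_series S).

Definition dseries_sum (t : nat -> nat -> C) (L : C) : Prop :=
  forall S : nat -> C, (forall m, is_series (t m) (S m)) -> is_series S L.

(* Main.v *)
Require Import Defs.
From Stdlib Require Import Reals Lra Lia Factorial Classical.
From Coquelicot Require Import Coquelicot.
Open Scope C_scope.

(** Write [b = beta - eps].  By Abel's theorem the sum of the rows [S m] is the
    limit at [x = 1] of [sum S_m x^m]; with [x = u / (1 - u)], Pfaff's
    transformation in the index [m] turns this power series into an absolutely
    convergent double series in [u < 1/2], whose value at [u = 1/2] collapses, by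
    Chu-Vandermonde, to [2^(-alpha) 2F1(b, 1 - b + i; beta; 1/2)] (respectively
    [1 - b - i]).  For [i = 0], [F(c) = 2F1(b, 1 - b; c; 1/2)] satisfies a
    two-term recurrence relating [F(c)] to [F(c + 2)], and [F(c) -> 1] as
    [c -> oo]; Gauss' limit for Gamma then evaluates it (Bailey's theorem).  Two
    contiguous relations, which become Pascal's rule on the right-hand sides, give
    the general [i] by induction.

    Dividing [F(c)] by [Gamma c] throughout makes everything meaningful for every
    [c], so the non-positive integers among the intermediate parameters
    [beta - i + r] need no separate treatment. *)

(** * Complex sequences and series *)

(** The obstacle is that the outer argument -1 lies on the circle of convergence. Only the
    convergence of the iterated sum is given, possibly conditional, so the double series cannot be
    rearranged where it stands. At x < 1 everything converges absolutely. As x tends to 1, u tends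
    to 1/2, which is interior for the transformed series in u, of radius at least 1, so the limit on
    that side needs only dominated convergence.

    The arguments -1 and 1/2 are tied together: Pfaff's map sends the first to the second. The
    remaining double series then has the same argument in both indices, and its antidiagonals
    collapse. The parameters alpha and gamma survive only through their sum, which the fourth
    parameter of the theorem is chosen to make equal to 1 - b + i or 1 - b - i.

    The recurrence moves c by 2, so its iteration produces Pochhammer symbols of half arguments.
    This is the origin of the Gamma values at halves and, through (2M)^z = 2^z M^z, of the powers of
    2. *)

Definition cv (u : nat -> C) (l : C) : Prop :=
  is_lim_seq (fun n => Cmod (u n - l)) 0.

Definition sums (a : nat -> C) (l : C) : Prop := cv (fun n => csum n a) l.

Lemma cv_filterlim (u : nat -> C) (l : C) :
  cv u l <-> filterlim u eventually (@locally C_UniformSpace l).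
Proof.
split; intros H.
- apply (proj2 (filterlim_locally (U := C_UniformSpace) u l)); intros eps.
  apply is_lim_seq_spec in H. destruct (H eps) as [N HN].
  exists N; intros n Hn. specialize (HN n Hn).
  apply C_NormedModule_mixin_compat1.
  unfold minus, plus, opp; simpl.
  rewrite Rminus_0_r, Rabs_pos_eq in HN by apply Cmod_ge_0. exact HN.
- apply is_lim_seq_spec; intros eps.
  (* Balls of [C_UniformSpace] are products of real balls, so passing from them to [Cmod] costs a
     factor [sqrt 2]. *)
  assert (Hs : 0 < sqrt 2) by (apply sqrt_lt_R0; lra).
  assert (He : 0 < eps / sqrt 2) by (apply Rdiv_lt_0_compat; [apply cond_pos | lra]).
  destruct (proj1 (filterlim_locally (U := C_UniformSpace) u l) H (mkposreal _ He))
    as [N HN].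
  exists N; intros n Hn. specialize (HN n Hn).
  apply C_NormedModule_mixin_compat2 in HN.
  unfold minus, plus, opp in HN; simpl in HN.
  rewrite Rminus_0_r, Rabs_pos_eq by apply Cmod_ge_0.
  replace (pos eps) with (sqrt 2 * (eps / sqrt 2))%R by (field; lra). exact HN.
Qed.

Lemma sum_n_csum (a : nat -> C) (n : nat) :
  @sum_n C_NormedModule a n = csum n a.
Proof.
induction n as [|n IH].
- apply (@sum_O C_NormedModule).
- rewrite (@sum_Sn C_NormedModule), IH. reflexivity.
Qed.

Lemma is_series_sums (a : nat -> C) (l : C) :
  @is_series C_AbsRing C_NormedModule a l <-> sums a l.
Proof.
unfold is_series, sums. rewrite cv_filterlim.
split; intros H; refine (filterlim_ext _ _ _ H); intros n;
  rewrite <- ?sum_n_csum; auto.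
Qed.

Lemma cv_ext (u v : nat -> C) (l : C) : (forall n, u n = v n) -> cv u l -> cv v l.
Proof. intros E; apply is_lim_seq_ext; intros n; now rewrite E. Qed.

Lemma cv_ext_loc (u v : nat -> C) (l : C) :
  eventually (fun n => u n = v n) -> cv u l -> cv v l.
Proof.
intros [N E]; apply is_lim_seq_ext_loc; exists N; intros n Hn; now rewrite E.
Qed.

Lemma cv_le (u : nat -> C) (l : C) (e : nat -> R) :
  eventually (fun n => Cmod (u n - l) <= e n)%R -> is_lim_seq e 0 -> cv u l.
Proof.
intros [N H] He. apply (is_lim_seq_le_le_loc (fun _ => 0%R) _ e).
- exists N; intros n Hn; split; [apply Cmod_ge_0 | auto].
- apply is_lim_seq_const.
- exact He.
Qed.

Lemma cv_const (l : C) : cv (fun _ => l) l.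
Proof.
apply is_lim_seq_ext with (fun _ => 0%R); [|apply is_lim_seq_const].
intros _. replace (l - l) with (RtoC 0) by ring. now rewrite Cmod_0.
Qed.

Lemma is_lim_seq_plus0 (u v : nat -> R) :
  is_lim_seq u 0 -> is_lim_seq v 0 -> is_lim_seq (fun n => u n + v n)%R 0.
Proof.
intros Hu Hv. generalize (is_lim_seq_plus' _ _ _ _ Hu Hv).
now rewrite Rplus_0_r.
Qed.

Lemma is_lim_seq_scal0 (u : nat -> R) (c : R) :
  is_lim_seq u 0 -> is_lim_seq (fun n => c * u n)%R 0.
Proof.
intros Hu. generalize (is_lim_seq_mult' _ _ _ _ (is_lim_seq_const c) Hu).
now rewrite Rmult_0_r.
Qed.

Lemma cv_plus (u v : nat -> C) (l m : C) :
  cv u l -> cv v m -> cv (fun n => u n + v n) (l + m).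
Proof.
intros Hu Hv. apply cv_le with (2 := is_lim_seq_plus0 _ _ Hu Hv).
exists 0%nat; intros n _.
replace (u n + v n - (l + m)) with ((u n - l) + (v n - m)) by ring.
apply Cmod_triangle.
Qed.

Lemma cv_mult (u v : nat -> C) (l m : C) :
  cv u l -> cv v m -> cv (fun n => u n * v n) (l * m).
Proof.
intros Hu Hv.
assert (H1 := is_lim_seq_mult' _ _ _ _ Hu Hv). rewrite Rmult_0_l in H1.
assert (H2 := is_lim_seq_plus0 _ _ (is_lim_seq_scal0 _ (Cmod m) Hu)
                (is_lim_seq_scal0 _ (Cmod l) Hv)).
apply cv_le with (2 := is_lim_seq_plus0 _ _ H1 H2).
exists 0%nat; intros n _.
replace (u n * v n - l * m)
  with ((u n - l) * (v n - m) + (m * (u n - l) + l * (v n - m))) by ring.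
eapply Rle_trans; [apply Cmod_triangle|]. rewrite Cmod_mult.
apply Rplus_le_compat_l.
eapply Rle_trans; [apply Cmod_triangle|]. rewrite !Cmod_mult. apply Rle_refl.
Qed.

Lemma cv_scal (u : nat -> C) (l c : C) : cv u l -> cv (fun n => c * u n) (c * l).
Proof. intros H; apply cv_mult; [apply cv_const | exact H]. Qed.

Lemma cv_opp (u : nat -> C) (l : C) : cv u l -> cv (fun n => - u n) (- l).
Proof.
intros H. apply is_lim_seq_ext with (2 := H). intros n.
replace (- u n - - l) with (- (u n - l)) by ring. now rewrite Cmod_opp.
Qed.

Lemma cv_minus (u v : nat -> C) (l m : C) :
  cv u l -> cv v m -> cv (fun n => u n - v n) (l - m).
Proof. intros Hu Hv; apply cv_plus; [exact Hu | now apply cv_opp]. Qed.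

Lemma Cminus_eq0 (x y : C) : x - y = 0 -> x = y.
Proof. intros H. replace x with (x - y + y) by ring. rewrite H. ring. Qed.

Lemma cv_unique (u : nat -> C) (l m : C) : cv u l -> cv u m -> l = m.
Proof.
intros Hl Hm. assert (H := cv_minus _ _ _ _ Hl Hm).
assert (H0 : is_lim_seq (fun _ => Cmod (l - m)) 0).
{ apply is_lim_seq_ext with (2 := H). intros n.
  replace (u n - u n - (l - m)) with (- (l - m)) by ring. apply Cmod_opp. }
apply is_lim_seq_unique in H0. rewrite Lim_seq_const in H0.
injection H0 as H0. apply Cminus_eq0. now apply Cmod_eq_0.
Qed.

Lemma cv_Cmod (u : nat -> C) (l : C) :
  cv u l -> is_lim_seq (fun n => Cmod (u n)) (Cmod l).
Proof.
intros H.
assert (K : is_lim_seq (fun n => Cmod (u n) - Cmod l)%R 0).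
{ apply is_lim_seq_abs_0.
  apply (is_lim_seq_le_le (fun _ => 0%R) _ (fun n => Cmod (u n - l))).
  - intros n; split; [apply Rabs_pos|].
    assert (H1 := Cmod_triangle (u n - l) l). assert (H2 := Cmod_triangle (l - u n) (u n)).
    replace (u n - l + l) with (u n) in H1 by ring.
    replace (l - u n + u n) with l in H2 by ring.
    replace (l - u n) with (- (u n - l)) in H2 by ring. rewrite Cmod_opp in H2.
    apply Rabs_le; lra.
  - apply is_lim_seq_const.
  - exact H. }
generalize (is_lim_seq_plus' _ _ _ _ K (is_lim_seq_const (Cmod l))).
rewrite Rplus_0_l. apply is_lim_seq_ext; intros n; ring.
Qed.

Lemma cv_inv (u : nat -> C) (l : C) : l <> 0 -> cv u l -> cv (fun n => / u n) (/ l).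
Proof.
intros Hl H. assert (Pl := proj1 (Cmod_gt_0 l) Hl).
(* The constant comes from [Cmod l / 2 <= Cmod (u n)], true for large [n]. *)
apply cv_le with (2 := is_lim_seq_scal0 _ (2 / (Cmod l * Cmod l)) H).
assert (K := cv_Cmod _ _ H). apply is_lim_seq_spec in K.
assert (P2 : 0 < Cmod l / 2) by lra.
destruct (K (mkposreal _ P2)) as [N HN]. exists N; intros n Hn.
specialize (HN n Hn); simpl in HN. apply Rabs_def2 in HN.
assert (Hu : 0 < Cmod (u n)) by lra. assert (Hu' := proj2 (Cmod_gt_0 _) Hu).
replace (/ u n - / l) with (- ((u n - l) / (u n * l))) by (field; auto).
rewrite Cmod_opp, Cmod_div by (now apply Cmult_neq_0). rewrite Cmod_mult.
unfold Rdiv. rewrite (Rmult_comm (2 * _)). apply Rmult_le_compat_l; [apply Cmod_ge_0|].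
rewrite !Rinv_mult, <- Rmult_assoc. apply Rmult_le_compat_r.
- left; now apply Rinv_0_lt_compat.
- replace (2 * / Cmod l)%R with (/ (Cmod l / 2))%R by (field; lra).
  apply Rinv_le_contravar; lra.
Qed.

Lemma cv_subseq (u : nat -> C) (l : C) (phi : nat -> nat) :
  filterlim phi eventually eventually -> cv u l -> cv (fun n => u (phi n)) l.
Proof. intros Hp H. exact (is_lim_seq_subseq (fun n => Cmod (u n - l)) 0 phi Hp H). Qed.

Lemma cv_incr (u : nat -> C) (l : C) (k : nat) : cv u l <-> cv (fun n => u (n + k)%nat) l.
Proof. exact (is_lim_seq_incr_n (fun n => Cmod (u n - l)) k 0). Qed.

Lemma cv_Cmod_le (u : nat -> C) (l : C) (M : R) :
  cv u l -> (forall n, Cmod (u n) <= M)%R -> (Cmod l <= M)%R.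
Proof.
intros H HM.
exact (is_lim_seq_le _ _ (Finite (Cmod l)) (Finite M) HM (cv_Cmod _ _ H)
         (is_lim_seq_const M)).
Qed.

Lemma cv_components (u : nat -> C) (l : C) :
  cv u l <-> is_lim_seq (fun n => Re (u n)) (Re l) /\ is_lim_seq (fun n => Im (u n)) (Im l).
Proof.
assert (E : forall z : C, (Rabs (Re z) <= Cmod z /\ Rabs (Im z) <= Cmod z)%R).
{ intros z. assert (H := Rmax_Cmod z). unfold Re, Im.
  generalize (Rmax_l (Rabs (fst z)) (Rabs (snd z))) (Rmax_r (Rabs (fst z)) (Rabs (snd z))).
  lra. }
assert (lim_shift : forall (v : nat -> R) (r : R),
  is_lim_seq v r <-> is_lim_seq (fun n => Rabs (v n - r)) 0).
{ intros v r. rewrite <- is_lim_seq_abs_0. split; intros H.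
  - generalize (is_lim_seq_minus' _ _ _ _ H (is_lim_seq_const r)). now rewrite Rminus_diag.
  - generalize (is_lim_seq_plus' _ _ _ _ H (is_lim_seq_const r)).
    rewrite Rplus_0_l. apply is_lim_seq_ext; intros n; ring. }
rewrite (lim_shift _ (Re l)), (lim_shift _ (Im l)). split.
- intros H; split; apply (is_lim_seq_le_le (fun _ => 0%R) _ (fun n => Cmod (u n - l)));
    try exact H; try apply is_lim_seq_const; intros n; split; try apply Rabs_pos;
    apply (E (u n - l)).
- intros [H1 H2].
  apply cv_le with (2 := is_lim_seq_scal0 _ (sqrt 2) (is_lim_seq_plus0 _ _ H1 H2)).
  exists 0%nat; intros n _. eapply Rle_trans; [apply Cmod_2Rmax|].
  apply Rmult_le_compat_l; [apply sqrt_pos|].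
  apply Rmax_lub; unfold Re, Im, Cminus, Cplus, Copp; simpl;
  generalize (Rabs_pos (fst (u n) + - fst l)) (Rabs_pos (snd (u n) + - snd l));
  unfold Rminus; lra.
Qed.

(** * Finite sums and convergent series *)

Lemma csum_ext (n : nat) (f g : nat -> C) :
  (forall k, (k <= n)%nat -> f k = g k) -> csum n f = csum n g.
Proof.
induction n as [|n IH]; intros H; simpl; [apply H; lia|].
rewrite IH, (H (S n)) by (intros; try apply H; lia). reflexivity.
Qed.

Lemma csum_plus (n : nat) (f g : nat -> C) :
  csum n (fun k => f k + g k) = csum n f + csum n g.
Proof. induction n as [|n IH]; simpl; [|rewrite IH]; ring. Qed.

Lemma csum_scal (n : nat) (c : C) (f : nat -> C) :
  csum n (fun k => c * f k) = c * csum n f.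
Proof. induction n as [|n IH]; simpl; [|rewrite IH]; ring. Qed.

Lemma csum_shift (n : nat) (f : nat -> C) :
  csum (S n) f = f 0%nat + csum n (fun k => f (S k)).
Proof. induction n as [|n IH]; [reflexivity|]. simpl in *. rewrite IH. ring. Qed.

Lemma Cmod_csum (n : nat) (f : nat -> C) :
  (Cmod (csum n f) <= sum_f_R0 (fun k => Cmod (f k)) n)%R.
Proof.
induction n as [|n IH]; simpl; [apply Rle_refl|].
eapply Rle_trans; [apply Cmod_triangle|]. lra.
Qed.

Lemma cv_csum (n : nat) (u : nat -> nat -> C) (l : nat -> C) :
  (forall k, (k <= n)%nat -> cv (fun M => u M k) (l k)) ->
  cv (fun M => csum n (u M)) (csum n l).
Proof.
induction n as [|n IH]; intros H; simpl; [apply H; lia|].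
apply cv_plus; [apply IH; intros|]; apply H; lia.
Qed.

Lemma sums_ext (a b : nat -> C) (l : C) : (forall n, a n = b n) -> sums a l -> sums b l.
Proof. intros E. apply cv_ext; intros n; apply csum_ext; auto. Qed.

Lemma sums_unique (a : nat -> C) (l m : C) : sums a l -> sums a m -> l = m.
Proof. apply cv_unique. Qed.

(** A total function, so that a whole family of sums can be named without choice; its value means
    something only for a convergent series. *)
Definition csum_inf (a : nat -> C) : C :=
  (real (Lim_seq (fun n => Re (csum n a))), real (Lim_seq (fun n => Im (csum n a)))).

Lemma csum_inf_correct (a : nat -> C) : (exists l, sums a l) -> sums a (csum_inf a).
Proof.
intros [l Hl]. assert (H := Hl). apply cv_components in H. destruct H as [H1 H2].
apply is_lim_seq_unique in H1. apply is_lim_seq_unique in H2.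
unfold csum_inf. rewrite H1, H2. simpl. unfold Re, Im. now rewrite <- surjective_pairing.
Qed.

Lemma sums_plus (a b : nat -> C) (l m : C) :
  sums a l -> sums b m -> sums (fun n => a n + b n) (l + m).
Proof.
intros Ha Hb. apply cv_ext with (2 := cv_plus _ _ _ _ Ha Hb).
intros n; symmetry; apply csum_plus.
Qed.

Lemma sums_scal (a : nat -> C) (l c : C) : sums a l -> sums (fun n => c * a n) (c * l).
Proof.
intros H. apply cv_ext with (2 := cv_scal _ _ c H).
intros n; symmetry; apply csum_scal.
Qed.

Lemma sums_minus (a b : nat -> C) (l m : C) :
  sums a l -> sums b m -> sums (fun n => a n - b n) (l - m).
Proof.
intros Ha Hb. replace (l - m) with (l + (-(1)) * m) by ring.
apply sums_ext with (2 := sums_plus _ _ _ _ Ha (sums_scal _ _ (-(1)) Hb)).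
intros n; ring.
Qed.

Lemma sums_shift (a : nat -> C) (l : C) :
  sums (fun n => a (S n)) l <-> sums a (a 0%nat + l).
Proof.
unfold sums. rewrite (cv_incr (fun n => csum n a) _ 1). split; intros H.
- apply cv_ext with (2 := cv_plus _ _ _ _ (cv_const (a 0%nat)) H).
  intros n. rewrite Nat.add_1_r. symmetry. apply csum_shift.
- assert (K := cv_minus _ _ _ _ H (cv_const (a 0%nat))).
  replace (a 0%nat + l - a 0%nat) with l in K by ring.
  apply cv_ext with (2 := K). intros n. rewrite Nat.add_1_r, csum_shift. ring.
Qed.

Lemma sums_csum (n : nat) (a : nat -> nat -> C) (l : nat -> C) :
  (forall m, (m <= n)%nat -> sums (a m) (l m)) ->
  sums (fun k => csum n (fun m => a m k)) (csum n l).
Proof.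
induction n as [|n IH]; intros H; simpl; [apply H; lia|].
apply sums_plus; [apply IH; intros|]; apply H; lia.
Qed.

(** * Dominated convergence and double series *)

Lemma ex_sums_dominated (a : nat -> C) (g : nat -> R) :
  (forall n, Cmod (a n) <= g n)%R -> ex_series g -> exists l, sums a l.
Proof.
intros H Hg.
destruct (@ex_series_le C_AbsRing C_CompleteNormedModule a g H Hg) as [l Hl].
exists l. now apply is_series_sums.
Qed.

Lemma partial_sum_le (g : nat -> R) (G : R) (n : nat) :
  (forall k, 0 <= g k)%R -> is_series g G -> (sum_f_R0 g n <= G)%R.
Proof.
intros Pg HG. rewrite <- sum_n_Reals.
apply (is_lim_seq_incr_compare (fun n => sum_n g n)); [exact HG|].
intros k. rewrite sum_Sn. unfold plus; simpl. generalize (Pg (S k)); lra.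
Qed.

Lemma sums_tail_le (a : nat -> C) (g : nat -> R) (l : C) (G : R) (n : nat) :
  (forall k, Cmod (a k) <= g k)%R -> sums a l -> is_series g G ->
  (Cmod (l - csum n a) <= G - sum_f_R0 g n)%R.
Proof.
intros H Ha HG.
assert (Pg : forall k, (0 <= g k)%R).
{ intros k; eapply Rle_trans; [apply Cmod_ge_0 | apply H]. }
assert (K := cv_minus _ _ _ _ (proj1 (cv_incr _ _ n) Ha) (cv_const (csum n a))).
apply (cv_Cmod_le _ _ _ K). intros p.
apply Rle_trans with (sum_f_R0 g (p + n) - sum_f_R0 g n)%R.
2: generalize (partial_sum_le g G (p + n) Pg HG); lra.
induction p as [|p IH]; simpl.
- replace (csum n a - csum n a) with (RtoC 0) by ring. rewrite Cmod_0. lra.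
- replace (csum (p + n) a + a (S (p + n)) - csum n a)
    with (csum (p + n) a - csum n a + a (S (p + n))) by ring.
  eapply Rle_trans; [apply Cmod_triangle|]. generalize (H (S (p + n))); lra.
Qed.

(* Tannery's theorem. *)
Lemma sums_dominated_convergence (e : nat -> nat -> C) (f : nat -> C) (g : nat -> R)
    (s : nat -> C) (t : C) :
  (forall M k, Cmod (e M k) <= g k)%R -> ex_series g ->
  (forall k, cv (fun M => e M k) (f k)) ->
  (forall M, sums (e M) (s M)) -> sums f t -> cv s t.
Proof.
intros He [G HG] Hc Hs Ht.
assert (Hf : forall k, (Cmod (f k) <= g k)%R).
{ intros k; apply (cv_Cmod_le _ _ _ (Hc k)); intros; apply He. }
apply is_lim_seq_spec; intros eps.
assert (HG' := HG). unfold is_series in HG'.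
assert (HG2 : is_lim_seq (fun n => sum_n g n) G) by exact HG'.
apply is_lim_seq_spec in HG2.
assert (P4 : 0 < eps / 4) by (generalize (cond_pos eps); lra).
destruct (HG2 (mkposreal _ P4)) as [K HK]. specialize (HK K (le_n K)).
simpl in HK. rewrite sum_n_Reals in HK. apply Rabs_def2 in HK.
assert (L := cv_csum K e f (fun k _ => Hc k)). apply is_lim_seq_spec in L.
destruct (L (mkposreal _ P4)) as [N HN]. exists N; intros M HM.
specialize (HN M HM); simpl in HN.
rewrite Rminus_0_r, Rabs_pos_eq in HN |- * by apply Cmod_ge_0.
replace (s M - t) with ((s M - csum K (e M)) + ((csum K (e M) - csum K f)
  + - (t - csum K f))) by ring.
eapply Rle_lt_trans; [apply Cmod_triangle|].
assert (T := Cmod_triangle (csum K (e M) - csum K f) (- (t - csum K f))).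
rewrite Cmod_opp in T.
generalize (sums_tail_le _ _ _ _ K (He M) (Hs M) HG) (sums_tail_le _ _ _ _ K Hf Ht HG).
lra.
Qed.

(** Here [f] is [g] cut off after [k], and [M] may lie on either side of [k]. *)
Lemma sum_f_R0_le_zero_ext (f g : nat -> R) (k M : nat) :
  (forall m, 0 <= g m)%R -> (forall m, (m <= k)%nat -> f m = g m) ->
  (forall m, (k < m)%nat -> f m = 0%R) -> (sum_f_R0 f M <= sum_f_R0 g k)%R.
Proof.
intros Pg E Z.
assert (Inc : forall p q, (p <= q)%nat -> (sum_f_R0 g p <= sum_f_R0 g q)%R).
{ intros p q Hpq. induction Hpq as [|q _ IH]; [apply Rle_refl|].
  simpl. generalize (Pg (S q)); lra. }
induction M as [|M IH].
- simpl. rewrite E by lia. apply (Inc 0%nat k); lia.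
- destruct (Nat.le_gt_cases (S M) k) as [H|H].
  + rewrite (sum_eq f g (S M)) by (intros; apply E; lia). now apply Inc.
  + simpl. rewrite (Z (S M)) by lia. lra.
Qed.

(** Fubini along antidiagonals, as an instance of Tannery's theorem: the sum of the first [M] rows
    converges, antidiagonal by antidiagonal, under the majorant [g]. *)
Lemma sums_diagonal (a : nat -> nat -> C) (g : nat -> R) :
  (forall k, sum_f_R0 (fun m => Cmod (a m (k - m)%nat)) k <= g k)%R -> ex_series g ->
  exists (row : nat -> C) (L : C),
    (forall m, sums (a m) (row m)) /\ sums row L /\
    sums (fun k => csum k (fun m => a m (k - m)%nat)) L.
Proof.
intros H Hg.
(* Row [m] is moved [m] places to the right and padded with zeros. Row sums do not change, and
   column [k] becomes antidiagonal [k]. *)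
set (b := fun m k => if (m <=? k)%nat then a m (k - m)%nat else RtoC 0).
assert (Hb1 : forall m k, (m <= k)%nat -> b m k = a m (k - m)%nat).
{ intros m k Hmk; unfold b. now rewrite (proj2 (Nat.leb_le m k) Hmk). }
assert (Hb0 : forall m k, (k < m)%nat -> b m k = 0).
{ intros m k Hmk; unfold b. now rewrite (proj2 (Nat.leb_gt m k) Hmk). }
assert (Bs : forall M k, (sum_f_R0 (fun m => Cmod (b m k)) M <= g k)%R).
{ intros M k. eapply Rle_trans; [|apply H].
  apply sum_f_R0_le_zero_ext; intros m; try apply Cmod_ge_0; intros Hm.
  - now rewrite Hb1.
  - now rewrite Hb0, Cmod_0. }
assert (Bb : forall m k, (Cmod (b m k) <= g k)%R).
{ intros m k. eapply Rle_trans; [|apply (Bs m k)].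
  destruct m as [|m]; simpl; [apply Rle_refl|].
  generalize (cond_pos_sum (fun m => Cmod (b m k)) m (fun _ => Cmod_ge_0 _)). lra. }
assert (Ex : forall m, exists l, sums (b m) l).
{ intros m. now apply ex_sums_dominated with g. }
assert (Sh : forall m n, csum (n + m) (b m) = csum n (a m)).
{ intros m n. induction n as [|n IH].
  - simpl. destruct m as [|m]; simpl; [reflexivity|].
    rewrite (Hb1 (S m) (S m)), Nat.sub_diag by lia.
    rewrite (csum_ext m _ (fun _ => 0 * 0)) by (intros; rewrite Hb0 by lia; ring).
    rewrite csum_scal. ring.
  - simpl. rewrite IH, Hb1 by lia. do 2 f_equal. lia. }
set (row := fun m => csum_inf (b m)).
assert (Hrow : forall m, sums (b m) (row m)) by (intros m; now apply csum_inf_correct).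
exists row.
assert (Bd : forall M k, (Cmod (csum M (fun m => b m k)) <= g k)%R).
{ intros M k. eapply Rle_trans; [apply Cmod_csum | apply Bs]. }
assert (Ed : forall k M, (k <= M)%nat ->
  csum M (fun m => b m k) = csum k (fun m => a m (k - m)%nat)).
{ intros k M Hk. induction Hk as [|M Hk IH].
  - apply csum_ext; intros; now apply Hb1.
  - simpl. rewrite IH, Hb0 by lia. ring. }
destruct (ex_sums_dominated (fun k => csum k (fun m => a m (k - m)%nat)) g) as [L HL].
- intros k. rewrite <- (Ed k k) by lia. apply Bd.
- exact Hg.
- exists L. repeat split; [|
  apply (sums_dominated_convergence (fun M k => csum M (fun m => b m k))
           (fun k => csum k (fun m => a m (k - m)%nat)) g); auto|exact HL].
  + intros m. specialize (Hrow m). apply (proj1 (cv_incr _ _ m)) in Hrow.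
    apply cv_ext with (2 := Hrow). intros n; apply Sh.
  + intros k. apply cv_ext_loc with (2 := cv_const _). exists k; intros M HM.
    symmetry; now apply Ed.
  + intros M. now apply sums_csum.
Qed.

(** * Binomial sums and Pochhammer symbols *)

Local Notation NC n := (RtoC (INR n)).

Lemma NC_S (n : nat) : NC (S n) = NC n + 1.
Proof. now rewrite S_INR, RtoC_plus. Qed.

Lemma NC_add (m n : nat) : NC (m + n) = NC m + NC n.
Proof. now rewrite plus_INR, RtoC_plus. Qed.

Lemma NC_mul (m n : nat) : NC (m * n) = NC m * NC n.
Proof. now rewrite mult_INR, RtoC_mult. Qed.

Lemma NC_neq0 (n : nat) : n <> 0%nat -> NC n <> 0.
Proof. intros Hn H. apply RtoC_inj in H. revert H. now apply not_0_INR. Qed.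

Lemma fact_C_neq0 (n : nat) : NC (fact n) <> 0.
Proof. apply NC_neq0, fact_neq_0. Qed.

Lemma Cmod_NC (n : nat) : Cmod (NC n) = INR n.
Proof. rewrite Cmod_R. apply Rabs_pos_eq, pos_INR. Qed.

Lemma fact_C_S (n : nat) : NC (fact (S n)) = (NC n + 1) * NC (fact n).
Proof. rewrite fact_simpl, NC_mul, NC_S. reflexivity. Qed.

Lemma cpown_Cpow (z : C) (n : nat) : cpown z n = z ^ n.
Proof. induction n as [|n IH]; simpl; [reflexivity|]. rewrite IH. ring. Qed.

Lemma binom_gt (n k : nat) : (n < k)%nat -> binom n k = 0%nat.
Proof.
revert k; induction n as [|n IH]; intros [|k] H; simpl; try lia.
rewrite !IH by lia. reflexivity.
Qed.

Lemma binom_fact (k m : nat) : (m <= k)%nat ->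
  (binom k m * (fact m * fact (k - m)) = fact k)%nat.
Proof.
revert m; induction k as [|k IH]; intros [|m] H; try lia; try reflexivity.
- simpl. lia.
- change (binom (S k) (S m)) with (binom k m + binom k (S m))%nat.
  replace (S k - S m)%nat with (k - m)%nat by lia.
  assert (H1 := IH m ltac:(lia)).
  destruct (Nat.eq_dec m k) as [->|Hne].
  + rewrite (binom_gt k (S k)) by lia. rewrite !fact_simpl.
    transitivity (S k * (binom k k * (fact k * fact (k - k))))%nat; [ring | now rewrite H1].
  + assert (H2 := IH (S m) ltac:(lia)).
    replace (k - m)%nat with (S (k - S m)) in * by lia.
    set (j := (k - S m)%nat) in *. assert (Ek : S k = (S m + S j)%nat) by (unfold j; lia).
    rewrite (fact_simpl k), Ek.
    transitivity (S m * (binom k m * (fact m * fact (S j)))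
                  + S j * (binom k (S m) * (fact (S m) * fact j)))%nat.
    * rewrite !fact_simpl. ring.
    * rewrite H1, H2. ring.
Qed.

Lemma binom_C (k m : nat) : (m <= k)%nat ->
  NC (binom k m) = NC (fact k) / (NC (fact m) * NC (fact (k - m))).
Proof.
intros H. rewrite <- (binom_fact k m H), !NC_mul. field.
split; apply fact_C_neq0.
Qed.

Definition bsum (i : nat) (f : nat -> C) : C := csum i (fun r => NC (binom i r) * f r).

Lemma bsum_ext (i : nat) (f g : nat -> C) :
  (forall k, (k <= i)%nat -> f k = g k) -> bsum i f = bsum i g.
Proof. intros H; apply csum_ext; intros k Hk; now rewrite H. Qed.

Lemma bsum_scal (i : nat) (c : C) (f : nat -> C) :
  bsum i (fun r => c * f r) = c * bsum i f.
Proof. unfold bsum. rewrite <- csum_scal. apply csum_ext; intros; ring. Qed.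

Lemma binom_0_r (n : nat) : binom n 0 = 1%nat.
Proof. now destruct n. Qed.

(** Pascal's rule in operator form. Every induction on the order of a binomial sum below goes
    through this identity, with the remaining parameters generalized to absorb the shift of [f]. *)
Lemma bsum_S (i : nat) (f : nat -> C) :
  bsum (S i) f = bsum i f + bsum i (fun r => f (S r)).
Proof.
unfold bsum. rewrite csum_shift.
assert (E : csum i (fun r => NC (binom i r) * f r)
  = csum (S i) (fun r => NC (binom i r) * f r)).
{ simpl. rewrite (binom_gt i (S i)) by lia. simpl. ring. }
rewrite E, csum_shift, !binom_0_r.
rewrite <- Cplus_assoc, <- csum_plus. f_equal.
apply csum_ext; intros k _.
change (binom (S i) (S k)) with (binom i k + binom i (S k))%nat.
rewrite NC_add. ring.
Qed.

Lemma bsum_pow (i : nat) (z : C) : bsum i (fun r => z ^ r) = (1 + z) ^ i.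
Proof.
induction i as [|i IH]; [unfold bsum; simpl; ring|].
rewrite bsum_S. simpl. rewrite (bsum_scal i z (fun r => z ^ r)), IH. ring.
Qed.

(** * Pochhammer symbols *)

Lemma poch_S (a : C) (n : nat) : poch a (S n) = poch a n * (a + NC n).
Proof. reflexivity. Qed.

Lemma poch_shift (a : C) (n : nat) : poch a (S n) = a * poch (a + 1) n.
Proof.
induction n as [|n IH]; [simpl; ring|].
change (poch a (S n) * (a + NC (S n)) = a * (poch (a + 1) n * (a + 1 + NC n))).
rewrite IH, NC_S. ring.
Qed.

Lemma poch_add (a : C) (m n : nat) : poch a (m + n) = poch a m * poch (a + NC m) n.
Proof.
induction n as [|n IH]; [rewrite Nat.add_0_r; simpl; ring|].
rewrite Nat.add_succ_r. simpl. rewrite IH, NC_add. ring.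
Qed.

Lemma not_npint_neq (c : C) (n : nat) : not_npint c -> c + NC n <> 0.
Proof.
intros H E. apply (H n). replace c with (c + NC n - NC n) by ring. rewrite E. ring.
Qed.

Lemma poch_neq0 (c : C) (n : nat) : not_npint c -> poch c n <> 0.
Proof.
intros H; induction n as [|n IH]; simpl; [apply C1_nz|].
apply Cmult_neq_0; [exact IH | now apply not_npint_neq].
Qed.

Lemma not_npint_add (c : C) (n : nat) : not_npint c -> not_npint (c + NC n).
Proof.
intros H k E. apply (H (k + n)%nat). rewrite NC_add.
replace c with (c + NC n - NC n) by ring. rewrite E. ring.
Qed.

(* Chu-Vandermonde. *)
Lemma bsum_poch_ratio (k : nat) (a c : C) : not_npint c ->
  bsum k (fun m => (-(1)) ^ m * (poch a m / poch c m)) = poch (c - a) k / poch c k.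
Proof.
revert a c; induction k as [|k IH]; intros a c Hc.
- unfold bsum; simpl. field.
- assert (Hc0 : c <> 0) by (generalize (not_npint_neq c 0 Hc); simpl; now rewrite Cplus_0_r).
  assert (Hc1 := not_npint_add c 1 Hc). change (NC 1) with (RtoC 1) in Hc1.
  rewrite bsum_S, IH by exact Hc.
  rewrite (bsum_ext k (fun r => (-(1)) ^ S r * _)
    (fun r => (-(a / c)) * ((-(1)) ^ r * (poch (a + 1) r / poch (c + 1) r)))).
  + rewrite bsum_scal, IH by exact Hc1.
    replace (c + 1 - (a + 1)) with (c - a) by ring.
    assert (E : poch c k * (c + NC k) = c * poch (c + 1) k) by apply (poch_shift c k).
    assert (N1 := poch_neq0 _ k Hc). assert (N2 := poch_neq0 _ k Hc1).
    assert (N3 := not_npint_neq c k Hc).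
    simpl. replace (poch (c + 1) k) with (poch c k * (c + NC k) / c) by (rewrite E; now field).
    field. auto.
  + intros r _. rewrite !poch_shift. simpl. field.
    split; [now apply poch_neq0 | exact Hc0].
Qed.

(** Chu-Vandermonde in convolution form: comparing coefficients in (1-x)^(-a) (1-x)^(-b) =
    (1-x)^(-a-b). *)
Lemma bsum_poch_mul (n : nat) (a b : C) :
  bsum n (fun k => poch a k * poch b (n - k)) = poch (a + b) n.
Proof.
revert a b; induction n as [|n IH]; intros a b; [unfold bsum; simpl; ring|].
rewrite bsum_S, poch_shift.
rewrite (bsum_ext n (fun k => poch a k * poch b (S n - k))
  (fun k => b * (poch a k * poch (b + 1) (n - k)))).
2: intros k Hk; rewrite Nat.sub_succ_l, poch_shift by exact Hk; ring.
rewrite (bsum_ext n (fun k => poch a (S k) * poch b (S n - S k))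
  (fun k => a * (poch (a + 1) k * poch b (n - k)))).
2: intros k Hk; rewrite poch_shift; simpl; ring.
rewrite !bsum_scal, !IH. replace (a + 1 + b) with (a + b + 1) by ring.
replace (a + (b + 1)) with (a + b + 1) by ring. ring.
Qed.

(** * Subexponential growth *)

(* The class of coefficient sequences whose power series have radius at least 1. *)
Definition subexp (v : nat -> C) : Prop :=
  forall rho : R, (1 < rho)%R ->
  exists M : R, (0 <= M)%R /\ forall n, (Cmod (v n) <= M * rho ^ n)%R.

(** From some [N] on, one step multiplies the modulus by at most [rho]; the finitely many earlier
    terms go into the constant. *)
Lemma subexp_ratio (v q : nat -> C) :
  cv q 1 -> eventually (fun n => v (S n) = q n * v n) -> subexp v.
Proof.
intros Hq [N0 Hv] rho Hrho.
assert (K := cv_Cmod _ _ Hq). rewrite Cmod_1 in K. apply is_lim_seq_spec in K.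
assert (Pr : 0 < rho - 1) by lra.
destruct (K (mkposreal _ Pr)) as [N1 HN1]. simpl in HN1.
set (N := Nat.max N0 N1).
(* This sum dominates each of [v 0], ..., [v N], which avoids a finite maximum. *)
exists (sum_f_R0 (fun k => Cmod (v k)) N).
assert (P : (0 <= sum_f_R0 (fun k => Cmod (v k)) N)%R).
{ apply cond_pos_sum; intros; apply Cmod_ge_0. }
split; [exact P|].
assert (R1 : forall n, (1 <= rho ^ n)%R) by (intros; apply pow_R1_Rle; lra).
induction n as [|n IH].
- apply Rle_trans with (sum_f_R0 (fun k => Cmod (v k)) 0).
  + simpl. lra.
  + rewrite pow_O, Rmult_1_r.
    apply (sum_f_R0_le_zero_ext (fun k => if (k <=? N)%nat then Cmod (v k) else 0%R)
             (fun k => Cmod (v k)) N 0).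
    * intros; apply Cmod_ge_0.
    * intros m Hm; now rewrite (proj2 (Nat.leb_le m N) Hm).
    * intros m Hm; now rewrite (proj2 (Nat.leb_gt m N) Hm).
- destruct (Nat.le_gt_cases N n) as [H|H].
  + rewrite Hv by lia. rewrite Cmod_mult. simpl.
    specialize (HN1 n ltac:(lia)). apply Rabs_def2 in HN1.
    rewrite (Rmult_comm rho), <- Rmult_assoc, Rmult_comm.
    apply Rmult_le_compat; try apply Cmod_ge_0; lra.
  + apply Rle_trans with (sum_f_R0 (fun k => Cmod (v k)) N * 1)%R.
    2: apply Rmult_le_compat_l; [exact P | apply R1].
    rewrite Rmult_1_r.
    apply Rle_trans with (sum_f_R0 (fun k => Cmod (v k)) (S n)).
    * simpl. generalize (cond_pos_sum (fun k => Cmod (v k)) n (fun k => Cmod_ge_0 _)). lra.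
    * rewrite (sum_eq _ (fun k => if (k <=? N)%nat then Cmod (v k) else 0%R)).
      2: intros i Hi; now rewrite (proj2 (Nat.leb_le i N)) by lia.
      apply sum_f_R0_le_zero_ext.
      -- intros; apply Cmod_ge_0.
      -- intros m Hm; now rewrite (proj2 (Nat.leb_le m N) Hm).
      -- intros m Hm; now rewrite (proj2 (Nat.leb_gt m N) Hm).
Qed.

Lemma subexp_mult (u v : nat -> C) : subexp u -> subexp v -> subexp (fun n => u n * v n).
Proof.
intros Hu Hv rho Hrho.
assert (Hs : 1 < sqrt rho) by (rewrite <- sqrt_1; apply sqrt_lt_1; lra).
destruct (Hu _ Hs) as [M [PM HM]], (Hv _ Hs) as [M' [PM' HM']].
exists (M * M')%R; split; [now apply Rmult_le_pos|]. intros n.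
rewrite Cmod_mult.
replace (rho ^ n)%R with (sqrt rho ^ n * sqrt rho ^ n)%R
  by (rewrite <- Rpow_mult_distr, sqrt_sqrt by lra; reflexivity).
replace (M * M' * (sqrt rho ^ n * sqrt rho ^ n))%R
  with ((M * sqrt rho ^ n) * (M' * sqrt rho ^ n))%R by ring.
apply Rmult_le_compat; auto using Cmod_ge_0.
Qed.

Lemma subexp_ext (u v : nat -> C) : (forall n, u n = v n) -> subexp u -> subexp v.
Proof.
intros E H rho Hr. destruct (H rho Hr) as [M [PM HM]]. exists M; split; auto.
intros n; now rewrite <- E.
Qed.

Lemma cv_inv_S : cv (fun n => / (NC n + 1)) 0.
Proof.
apply is_lim_seq_ext with (fun n => / (INR n + 1))%R.
- intros n. replace (/ (NC n + 1) - 0) with (/ (NC n + 1)) by ring.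
  rewrite <- NC_S, Cmod_inv, Cmod_NC, S_INR by (apply NC_neq0; lia). reflexivity.
- apply (is_lim_seq_inv (fun n => INR n + 1)%R p_infty); [|discriminate].
  eapply is_lim_seq_plus; [apply is_lim_seq_INR | apply is_lim_seq_const | reflexivity].
Qed.

Lemma NC_S_neq0 (n : nat) : NC n + 1 <> 0.
Proof. rewrite <- NC_S. apply NC_neq0; lia. Qed.

Lemma cv_ratio_lin (a : C) : cv (fun n => (a + NC n) / (NC n + 1)) 1.
Proof.
assert (H := cv_plus _ _ _ _ (cv_const 1) (cv_scal _ _ (a - 1) cv_inv_S)).
replace (1 + (a - 1) * 0) with (RtoC 1) in H by ring.
apply cv_ext with (2 := H). intros n. field. apply NC_S_neq0.
Qed.

Lemma eventually_add_neq0 (a : C) : eventually (fun n => a + NC n <> 0).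
Proof.
destruct (INR_unbounded (Cmod a)) as [N HN]. exists N; intros n Hn E.
assert (K : NC n = - a) by (replace (NC n) with (a + NC n - a) by ring; rewrite E; ring).
apply (f_equal Cmod) in K. rewrite Cmod_NC, Cmod_opp in K.
apply le_INR in Hn. lra.
Qed.

Lemma cv_ratio_lin_inv (a : C) : cv (fun n => (NC n + 1) / (a + NC n)) 1.
Proof.
assert (H := cv_inv _ _ C1_nz (cv_ratio_lin a)).
replace (/ RtoC 1) with (RtoC 1) in H by field.
apply cv_ext_loc with (2 := H). destruct (eventually_add_neq0 a) as [N HN].
exists N; intros n Hn. field. split; auto using NC_S_neq0.
Qed.

Lemma subexp_poch_fact (a : C) : subexp (fun n => poch a n / NC (fact n)).
Proof.
apply subexp_ratio with (1 := cv_ratio_lin a). exists 0%nat; intros n _.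
rewrite fact_C_S. simpl poch. field. split; [apply fact_C_neq0 | apply NC_S_neq0].
Qed.

Lemma subexp_fact_poch (c : C) : not_npint c -> subexp (fun n => NC (fact n) / poch c n).
Proof.
intros Hc. apply subexp_ratio with (1 := cv_ratio_lin_inv c). exists 0%nat; intros n _.
rewrite fact_C_S. simpl poch. field.
split; [now apply poch_neq0 | now apply not_npint_neq].
Qed.

Lemma ex_series_geom_scal (M q : R) : (0 <= q < 1)%R -> ex_series (fun n => M * q ^ n)%R.
Proof.
intros Hq. apply (ex_series_scal (V := R_NormedModule) M).
apply ex_series_geom. rewrite Rabs_pos_eq; lra.
Qed.

Lemma subexp_geom (v : nat -> C) (r : R) : subexp v -> (0 <= r < 1)%R ->
  exists M q : R, (0 <= M /\ 0 <= q < 1)%R /\ forall n, (Cmod (v n) * r ^ n <= M * q ^ n)%R.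
Proof.
(* Chosen so that [1 < rho] and [rho * r < 1]; the ratio [q] is [rho * r]. *)
intros Hv Hr. set (rho := (2 / (1 + r))%R).
assert (H1 : 1 < rho) by (unfold rho; apply Rlt_div_r; lra).
destruct (Hv rho H1) as [M [PM HM]]. exists M, (rho * r)%R. repeat split; auto.
- apply Rmult_le_pos; lra.
- unfold rho. replace (2 / (1 + r) * r)%R with (2 * r / (1 + r))%R by (field; lra).
  apply Rlt_div_l; lra.
- intros n. rewrite Rpow_mult_distr, <- Rmult_assoc.
  apply Rmult_le_compat_r; [apply pow_le; lra | auto].
Qed.

Lemma ex_series_subexp (v : nat -> C) (r : R) : subexp v -> (0 <= r < 1)%R ->
  ex_series (fun n => Cmod (v n) * r ^ n)%R.
Proof.
intros Hv Hr. destruct (subexp_geom v r Hv Hr) as [M [q [[PM Hq] H]]].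
apply (ex_series_le (V := R_CompleteNormedModule) _ (fun n => M * q ^ n)%R).
- intros n. change (Rabs (Cmod (v n) * r ^ n) <= M * q ^ n)%R.
  rewrite Rabs_pos_eq; auto. apply Rmult_le_pos; [apply Cmod_ge_0 | apply pow_le; lra].
- now apply ex_series_geom_scal.
Qed.

Lemma Cmod_scal_pow (v : C) (r : R) (n : nat) : (0 <= r)%R ->
  Cmod (v * RtoC r ^ n) = (Cmod v * r ^ n)%R.
Proof. intros Hr. rewrite Cmod_mult, Cmod_pow, Cmod_R, Rabs_pos_eq; auto. Qed.

Lemma ex_sums_subexp (v : nat -> C) (r : R) : subexp v -> (0 <= r < 1)%R ->
  exists l, sums (fun n => v n * RtoC r ^ n) l.
Proof.
intros Hv Hr. apply ex_sums_dominated with (2 := ex_series_subexp v r Hv Hr).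
intros n. rewrite Cmod_scal_pow by lra. apply Rle_refl.
Qed.

(** * The binomial series *)

Lemma cpowR_add (a : R) (z w : C) : cpowR a (z + w) = cpowR a z * cpowR a w.
Proof.
unfold cpowR. destruct z as [x y], w as [x' y'].
unfold Re, Im, Cplus, Cmult, RtoC; simpl.
rewrite !Rmult_plus_distr_r, exp_plus, cos_plus, sin_plus.
f_equal; ring.
Qed.

Lemma cpowR_mult_base (a b : R) (z : C) : 0 < a -> 0 < b ->
  cpowR (a * b) z = cpowR a z * cpowR b z.
Proof.
intros Ha Hb. unfold cpowR. rewrite ln_mult by assumption.
destruct z as [x y]. unfold Re, Im, Cmult, RtoC; simpl.
rewrite !Rmult_plus_distr_l, exp_plus, cos_plus, sin_plus.
f_equal; ring.
Qed.

Lemma cpowR_0 (a : R) : cpowR a 0 = 1.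
Proof.
unfold cpowR, Re, Im, RtoC, Cmult; simpl. rewrite !Rmult_0_l, exp_0, cos_0, sin_0.
f_equal; ring.
Qed.

Lemma cpowR_1_base (z : C) : cpowR 1 z = 1.
Proof.
unfold cpowR, Re, Im, RtoC, Cmult; simpl. rewrite ln_1, !Rmult_0_r, exp_0, cos_0, sin_0.
f_equal; ring.
Qed.

Lemma cpowR_1 (a : R) : 0 < a -> cpowR a 1 = RtoC a.
Proof.
intros Ha. unfold cpowR, Re, Im, RtoC, Cmult; simpl.
rewrite Rmult_0_l, Rmult_1_l, exp_ln, cos_0, sin_0 by exact Ha. f_equal; ring.
Qed.

Lemma cpowR_opp (a : R) (z : C) : cpowR a z * cpowR a (- z) = 1.
Proof. rewrite <- cpowR_add. replace (z + - z) with (RtoC 0) by ring. apply cpowR_0. Qed.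

Lemma Cmult_1_neq0 (x y : C) : x * y = 1 -> x <> 0.
Proof. intros H ->. rewrite Cmult_0_l in H. now apply C1_nz. Qed.

Lemma cpowR_neq0 (a : R) (z : C) : cpowR a z <> 0.
Proof. apply Cmult_1_neq0 with (1 := cpowR_opp a z). Qed.

Lemma cpowR_NC (a : R) (n : nat) : 0 < a -> cpowR a (NC n) = RtoC a ^ n.
Proof.
intros Ha. induction n as [|n IH]; [apply cpowR_0|].
rewrite NC_S, cpowR_add, IH, cpowR_1 by exact Ha. simpl. ring.
Qed.

Lemma Cmod_Im_le (z : C) : Rabs (Im z) <= Cmod z.
Proof.
eapply Rle_trans; [|apply Rmax_Cmod]. apply Rmax_r.
Qed.

Lemma subexp_CV_radius (v : nat -> C) (p : nat -> R) (x : R) :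
  subexp v -> (forall n, Rabs (p n) <= Cmod (v n)) -> Rabs x < 1 ->
  Rbar_lt (Rabs x) (CV_radius p).
Proof.
intros Hv Hp Hx. set (r := ((1 + Rabs x) / 2)%R).
assert (Px := Rabs_pos x). assert (Hr : 0 <= r < 1) by (unfold r; lra).
apply Rbar_lt_le_trans with r; [unfold r; simpl; lra|].
apply (proj1 (CV_radius_bounded p)).
destruct (subexp_geom v r Hv Hr) as [M [q [[PM Hq] H]]].
exists M. intros n. rewrite Rabs_mult, (Rabs_pos_eq (r ^ n)) by (apply pow_le; lra).
apply Rle_trans with (Cmod (v n) * r ^ n)%R.
- apply Rmult_le_compat_r; [apply pow_le; lra | apply Hp].
- eapply Rle_trans; [apply H|]. rewrite <- (Rmult_1_r M) at 2.
  apply Rmult_le_compat_l; [exact PM|].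
  rewrite <- (pow1 n). apply pow_incr; lra.
Qed.

Lemma Re_csum (n : nat) (f : nat -> C) : Re (csum n f) = sum_n (fun k => Re (f k)) n.
Proof.
induction n as [|n IH]; [now rewrite sum_O|]. rewrite sum_Sn, <- IH. reflexivity.
Qed.

Lemma Im_csum (n : nat) (f : nat -> C) : Im (csum n f) = sum_n (fun k => Im (f k)) n.
Proof.
induction n as [|n IH]; [now rewrite sum_O|]. rewrite sum_Sn, <- IH. reflexivity.
Qed.

Lemma Re_scal_pow (z : C) (x : R) (n : nat) : Re (z * RtoC x ^ n) = (Re z * x ^ n)%R.
Proof. rewrite <- RtoC_pow. unfold Re, Cmult, RtoC; simpl. ring. Qed.

Lemma Im_scal_pow (z : C) (x : R) (n : nat) : Im (z * RtoC x ^ n) = (Im z * x ^ n)%R.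
Proof. rewrite <- RtoC_pow. unfold Im, Cmult, RtoC; simpl. ring. Qed.

Lemma sums_pseries (c : nat -> C) (x : R) (l : C) :
  sums (fun n => c n * RtoC x ^ n) l <->
  is_pseries (fun n => Re (c n)) x (Re l) /\ is_pseries (fun n => Im (c n)) x (Im l).
Proof.
unfold sums. rewrite cv_components, !is_pseries_R.
assert (E1 : forall n, Re (csum n (fun n => c n * RtoC x ^ n))
  = sum_n (fun k => Re (c k) * x ^ k)%R n).
{ intros n; rewrite Re_csum. apply sum_n_ext; intros k; apply Re_scal_pow. }
assert (E2 : forall n, Im (csum n (fun n => c n * RtoC x ^ n))
  = sum_n (fun k => Im (c k) * x ^ k)%R n).
{ intros n; rewrite Im_csum. apply sum_n_ext; intros k; apply Im_scal_pow. }
split; intros [H1 H2]; split.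
- exact (is_lim_seq_ext _ _ (Finite (Re l)) E1 H1).
- exact (is_lim_seq_ext _ _ (Finite (Im l)) E2 H2).
- exact (is_lim_seq_ext _ _ (Finite (Re l)) (fun n => eq_sym (E1 n)) H1).
- exact (is_lim_seq_ext _ _ (Finite (Im l)) (fun n => eq_sym (E2 n)) H2).
Qed.

(** The recurrence is (1 - x) p' = a p + b q read coefficientwise. Two real series are needed
    because (1 - x) y' = a y with complex a couples the real and imaginary parts of y. *)
Lemma pseries_linear_ode (p q : nat -> R) (a b x : R) :
  (forall n, INR (S n) * p (S n) = INR n * p n + (a * p n + b * q n))%R ->
  Rbar_lt (Rabs x) (CV_radius p) -> Rbar_lt (Rabs x) (CV_radius q) ->
  ((1 - x) * PSeries (PS_derive p) x = a * PSeries p x + b * PSeries q x)%R.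
Proof.
intros E Hp Hq.
assert (D : PSeries (PS_derive p) x =
  PSeries (PS_plus (PS_incr_1 (PS_derive p)) (PS_plus (PS_scal a p) (PS_scal b q))) x).
{ apply PSeries_ext; intros n. unfold PS_plus, PS_scal, PS_derive, PS_incr_1.
  rewrite E. destruct n; unfold plus, scal, zero; simpl; unfold mult; simpl; ring. }
assert (Ep := CV_radius_inside _ _ Hp). assert (Eq := CV_radius_inside _ _ Hq).
assert (Ed := ex_pseries_derive _ _ Hp).
assert (Epq : ex_pseries (PS_plus (PS_scal a p) (PS_scal b q)) x).
{ apply ex_pseries_plus; apply ex_pseries_scal; auto; apply Rmult_comm. }
rewrite PSeries_plus, PSeries_incr_1, PSeries_plus, !PSeries_scal in D;
  try assumption.
- lra.
- apply ex_pseries_scal; auto; apply Rmult_comm.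
- apply ex_pseries_scal; auto; apply Rmult_comm.
- now apply ex_pseries_incr_1.
Qed.

(** The sum y solves (1 - x) y' = a y, so (1 - x)^a y has derivative zero on the real interval (-1,
    1) and keeps its value 1 at 0. *)
Lemma binomial_series (a : C) (u : R) : (0 <= u < 1)%R ->
  sums (fun n => poch a n / NC (fact n) * RtoC u ^ n) (cpowR (/ (1 - u)) a).
Proof.
intros Hu.
set (c := fun n => poch a n / NC (fact n)).
set (p := fun n => Re (c n)). set (q := fun n => Im (c n)).
assert (Rp : forall x, (Rabs x < 1)%R -> Rbar_lt (Rabs x) (CV_radius p)).
{ intros x. apply (subexp_CV_radius c); [apply subexp_poch_fact|].
  intros n; apply re_le_Cmod. }
assert (Rq : forall x, (Rabs x < 1)%R -> Rbar_lt (Rabs x) (CV_radius q)).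
{ intros x. apply (subexp_CV_radius c); [apply subexp_poch_fact|].
  intros n; apply Cmod_Im_le. }
assert (Ec : forall n, RtoC (INR (S n)) * c (S n) = (a + NC n) * c n).
{ intros n. unfold c. rewrite fact_C_S, NC_S. simpl poch. field.
  split; [apply fact_C_neq0 | apply NC_S_neq0]. }
assert (Dp : forall x, (Rabs x < 1)%R -> ((1 - x) * PSeries (PS_derive p) x
  = Re a * PSeries p x + (- Im a) * PSeries q x)%R).
{ intros x Hx. apply pseries_linear_ode; auto. intros n. unfold p, q.
  generalize (f_equal Re (Ec n)). unfold Re, Im, Cmult, Cplus, RtoC.
  cbn [fst snd]. intros K. ring_simplify in K. ring_simplify. lra. }
assert (Dq : forall x, (Rabs x < 1)%R -> ((1 - x) * PSeries (PS_derive q) x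
  = Re a * PSeries q x + Im a * PSeries p x)%R).
{ intros x Hx. apply pseries_linear_ode; auto. intros n. unfold p, q.
  generalize (f_equal Im (Ec n)). unfold Re, Im, Cmult, Cplus, RtoC.
  cbn [fst snd]. intros K. ring_simplify in K. ring_simplify. lra. }
(* [H1] and [H2] are the real and imaginary parts of [cpowR (1 - x) a] times the sum of the
   series. *)
set (H1 := fun x => (exp (Re a * ln (1 - x)) * (cos (Im a * ln (1 - x)) * PSeries p x
  - sin (Im a * ln (1 - x)) * PSeries q x))%R).
set (H2 := fun x => (exp (Re a * ln (1 - x)) * (cos (Im a * ln (1 - x)) * PSeries q x
  + sin (Im a * ln (1 - x)) * PSeries p x))%R).
assert (D1 : forall x, (Rabs x < 1)%R -> is_derive H1 x 0%R).
{ intros x Hx. assert (Hx' := Rabs_def2 _ _ Hx). unfold H1. auto_derive.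
  - repeat split; try lra; eapply ex_derive_PSeries; auto.
  - rewrite !Derive_PSeries by auto.
    replace (PSeries (PS_derive p) x) with ((Re a * PSeries p x + - Im a * PSeries q x) / (1 - x))%R
      by (rewrite <- Dp by exact Hx; field; lra).
    replace (PSeries (PS_derive q) x) with ((Re a * PSeries q x + Im a * PSeries p x) / (1 - x))%R
      by (rewrite <- Dq by exact Hx; field; lra).
    unfold Rminus. field. lra. }
assert (D2 : forall x, (Rabs x < 1)%R -> is_derive H2 x 0%R).
{ intros x Hx. assert (Hx' := Rabs_def2 _ _ Hx). unfold H2. auto_derive.
  - repeat split; try lra; eapply ex_derive_PSeries; auto.
  - rewrite !Derive_PSeries by auto.
    replace (PSeries (PS_derive p) x) with ((Re a * PSeries p x + - Im a * PSeries q x) / (1 - x))%R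
      by (rewrite <- Dp by exact Hx; field; lra).
    replace (PSeries (PS_derive q) x) with ((Re a * PSeries q x + Im a * PSeries p x) / (1 - x))%R
      by (rewrite <- Dq by exact Hx; field; lra).
    unfold Rminus. field. lra. }
assert (C0 : c 0%nat = 1) by (unfold c; simpl; field).
assert (Z0 : forall f : R -> R, (forall x, (Rabs x < 1)%R -> is_derive f x 0%R) -> f u = f 0%R).
{ intros f Hf. destruct (Req_dec u 0) as [->|Hn]; [reflexivity|].
  symmetry. apply (eq_is_derive f 0 u); [|lra].
  intros t Ht. apply Hf. rewrite Rabs_pos_eq; lra. }
assert (V1 := Z0 _ D1). assert (V2 := Z0 _ D2). unfold H1 in V1. unfold H2 in V2.
rewrite !PSeries_0, Rminus_0_r, ln_1, !Rmult_0_r, exp_0, cos_0, sin_0 in V1, V2.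
assert (E0 : cpowR (1 - u) a * (PSeries p u, PSeries q u) = 1).
{ unfold p at 2, q at 2 in V1. unfold p at 2, q at 2 in V2. rewrite C0 in V1, V2.
  unfold cpowR, Cmult, RtoC; simpl. simpl in V1, V2. f_equal; lra. }
assert (E1 : cpowR (/ (1 - u)) a = (PSeries p u, PSeries q u)).
{ rewrite <- (Cmult_1_r (cpowR _ _)), <- E0, Cmult_assoc, <- cpowR_mult_base.
  - rewrite Rinv_l, cpowR_1_base by lra. ring.
  - apply Rinv_0_lt_compat; lra.
  - lra. }
rewrite E1. apply sums_pseries. simpl.
assert (Hu' : (Rabs u < 1)%R) by (rewrite Rabs_pos_eq; lra).
split; apply PSeries_correct, CV_radius_inside; auto.
Qed.

Lemma sums_Cmod_le (a : nat -> C) (g : nat -> R) (l : C) (G : R) :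
  (forall k, Cmod (a k) <= g k)%R -> sums a l -> is_series g G -> (Cmod l <= G)%R.
Proof.
intros H Ha HG. apply (cv_Cmod_le _ _ _ Ha). intros n.
eapply Rle_trans; [apply Cmod_csum|].
apply Rle_trans with (sum_f_R0 g n); [now apply sum_Rle|].
apply partial_sum_le; auto.
intros k; eapply Rle_trans; [apply Cmod_ge_0 | apply H].
Qed.

(** * The Gamma function *)

(** The remainder is the binomial series without its first two terms; on [0, 1/2] a factor v^2 comes
    out and the rest is at most its value at 1/2. With v of order 1/n this makes Gauss' product for
    Gamma converge. *)
Lemma cpowR_second_order (z : C) : exists K : R, (0 <= K)%R /\
  forall v, (0 <= v <= / 2)%R ->
  (Cmod (cpowR (/ (1 - v)) z - (1 + z * RtoC v)) <= K * v ^ 2)%R.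
Proof.
set (c := fun n => poch z n / NC (fact n)).
assert (Hh : (0 <= / 2 < 1)%R) by lra.
assert (E := ex_series_subexp c (/ 2) (subexp_poch_fact z) Hh).
assert (E2 : ex_series (fun n => Cmod (c (S (S n))) * (/ 2) ^ n)%R).
{ apply (proj1 (ex_series_incr_n _ 2)) in E.
  apply (ex_series_scal (V := R_NormedModule) 4%R) in E.
  apply ex_series_ext with (2 := E). intros n.
  unfold scal; simpl; unfold mult; simpl. field. }
destruct E2 as [K HK]. exists K.
assert (PK : (0 <= K)%R).
{ apply Rle_trans with (2 := partial_sum_le _ _ 0%nat
    (fun k => Rmult_le_pos _ _ (Cmod_ge_0 _) (pow_le _ _ (proj1 Hh))) HK).
  simpl. apply Rmult_le_pos; [apply Cmod_ge_0 | lra]. }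
split; [exact PK|]. intros v Hv.
assert (B := binomial_series z v ltac:(lra)).
set (L := cpowR (/ (1 - v)) z) in *.
assert (B2 : sums (fun n => c (S (S n)) * RtoC v ^ S (S n)) (L - (1 + z * RtoC v))).
{ apply (sums_shift (fun n => c (S n) * RtoC v ^ S n)).
  apply (sums_shift (fun n => c n * RtoC v ^ n)).
  replace (c 0%nat * RtoC v ^ 0 + (c 1%nat * RtoC v ^ 1 + (L - (1 + z * v)))) with L.
  - exact B.
  - unfold c; simpl. field. }
rewrite Rmult_comm.
apply (sums_Cmod_le _ (fun n => v ^ 2 * (Cmod (c (S (S n))) * (/ 2) ^ n))%R _ _) with (2 := B2).
- intros n. rewrite Cmod_scal_pow by lra.
  replace (v ^ S (S n))%R with (v ^ 2 * v ^ n)%R by (simpl; ring).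
  rewrite <- Rmult_assoc, (Rmult_comm _ (v ^ 2)), Rmult_assoc.
  apply Rmult_le_compat_l; [apply pow2_ge_0|].
  apply Rmult_le_compat_l; [apply Cmod_ge_0|]. apply pow_incr; lra.
- apply (is_series_scal (V := R_NormedModule) (v ^ 2)%R). exact HK.
Qed.

Lemma ex_cv_increments (u : nat -> C) (g : nat -> R) :
  (forall n, Cmod (u (S n) - u n) <= g n)%R -> ex_series g -> exists l, cv u l.
Proof.
intros H Hg. destruct (ex_sums_dominated _ _ H Hg) as [l Hl].
exists (l + u 0%nat). apply (proj2 (cv_incr _ _ 1)).
apply cv_ext with (2 := cv_plus _ _ _ _ Hl (cv_const (u 0%nat))).
intros n. rewrite Nat.add_1_r. induction n as [|n IH]; simpl; [ring|].
rewrite <- Cplus_assoc, (Cplus_comm _ (u 0%nat)), Cplus_assoc, IH. ring.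
Qed.

(** The partial products are bounded by exp of the sum of [g], so their increments are summable. The
    limit may be 0; [cv_Gamma] excludes that separately. *)
Lemma ex_cv_product (p d : nat -> C) (g : nat -> R) :
  (forall n, p (S n) = p n * (1 + d n)) -> (forall n, Cmod (d n) <= g n)%R ->
  ex_series g -> exists l, cv p l.
Proof.
intros Hp Hd Hg. assert (Hg' := Hg). destruct Hg' as [G HG].
assert (Pg : forall k, (0 <= g k)%R).
{ intros k; eapply Rle_trans; [apply Cmod_ge_0 | apply Hd]. }
assert (B : forall n, (Cmod (p (S n)) <= Cmod (p 0%nat) * exp (sum_f_R0 g n))%R).
{ assert (step : forall n, (Cmod (p (S n)) <= Cmod (p n) * exp (g n))%R).
  { intros n. rewrite Hp, Cmod_mult. apply Rmult_le_compat_l; [apply Cmod_ge_0|].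
    eapply Rle_trans; [apply Cmod_triangle|]. rewrite Cmod_1.
    generalize (Hd n) (exp_ineq1_le (g n)). lra. }
  induction n as [|n IH]; [apply step|].
  eapply Rle_trans; [apply step|]. simpl sum_f_R0.
  rewrite exp_plus, <- Rmult_assoc. apply Rmult_le_compat_r; [left; apply exp_pos | exact IH]. }
set (M := (Cmod (p 0%nat) * exp G)%R).
assert (B' : forall n, (Cmod (p n) <= M)%R).
{ assert (PG : (0 <= G)%R).
  { eapply Rle_trans; [|apply (partial_sum_le g G 0 Pg HG)]. apply Pg. }
  intros [|n]; unfold M.
  - rewrite <- (Rmult_1_r (Cmod _)) at 1. apply Rmult_le_compat_l; [apply Cmod_ge_0|].
    generalize (exp_ineq1_le G); lra.
  - eapply Rle_trans; [apply B|]. apply Rmult_le_compat_l; [apply Cmod_ge_0|].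
    destruct (partial_sum_le g G n Pg HG) as [H| ->]; [left; now apply exp_increasing|apply Rle_refl]. }
apply (ex_cv_increments p (fun n => M * g n)%R).
- intros n. rewrite Hp. replace (p n * (1 + d n) - p n) with (p n * d n) by ring.
  rewrite Cmod_mult. apply Rmult_le_compat; auto using Cmod_ge_0.
- now apply (ex_series_scal (V := R_NormedModule) M).
Qed.

Lemma ex_series_inv_sqr : ex_series (fun n => (/ INR (S n)) ^ 2)%R.
Proof.
apply (proj2 (ex_series_incr_1 _)).
apply (ex_series_le (V := R_CompleteNormedModule) _ (fun n => / INR (S n) - / INR (S (S n)))%R).
- intros n.
  change (Rabs ((/ INR (S (S n))) ^ 2) <= / INR (S n) - / INR (S (S n)))%R.
  assert (H1 : 0 < INR (S n)) by (apply lt_0_INR; lia).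
  rewrite (S_INR (S n)). set (x := INR (S n)) in *. rewrite Rabs_pos_eq by apply pow2_ge_0.
  replace (/ x - / (x + 1))%R with (/ (x * (x + 1)))%R by (field; lra).
  rewrite pow_inv. apply Rinv_le_contravar; [apply Rmult_lt_0_compat; lra|]. nra.
- exists 1%R.
  assert (L : is_lim_seq (fun n => 1 - / INR (S (S n)))%R 1%R).
  { replace (Finite 1) with (Finite (1 - 0)) by (f_equal; ring).
    apply is_lim_seq_minus'; [apply is_lim_seq_const|].
    assert (H := is_lim_seq_inv INR p_infty is_lim_seq_INR ltac:(discriminate)).
    apply (proj1 (is_lim_seq_incr_n (fun n => / INR n)%R 2 0)) in H.
    apply is_lim_seq_ext with (2 := H). intros n. do 2 f_equal. lia. }
  apply (is_lim_seq_ext _ _ (Finite 1)) with (2 := L). intros n.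
  induction n as [|n IH]; [rewrite sum_O; simpl; field|].
  rewrite sum_Sn, <- IH. unfold plus; cbn -[INR]. ring.
Qed.

(** The quotient of consecutive terms is written in v = 1/(n+2), the form that [cpowR_second_order]
    estimates. Starting at [S n] keeps the base of the power positive. *)
Lemma Gamma_seq_S (z : C) (n : nat) : not_npint z ->
  Gamma_seq z (S (S n)) = Gamma_seq z (S n)
    * (cpowR (/ (1 - / INR (S (S n)))) z / (1 + z * RtoC (/ INR (S (S n))))).
Proof.
intros Hz. unfold Gamma_seq. set (m := S n).
change (poch z (S (S m))) with (poch z (S m) * (z + NC (S m))).
assert (Hm : 0 < INR m) by (apply lt_0_INR; unfold m; lia).
assert (HS : 0 < INR (S m)) by (apply lt_0_INR; lia).
replace (cpowR (INR (S m)) z)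
  with (cpowR (INR m) z * cpowR (/ (1 - / INR (S m))) z).
2: { rewrite <- cpowR_mult_base; [|exact Hm|].
  - f_equal. rewrite S_INR. field. rewrite S_INR in HS. lra.
  - apply Rinv_0_lt_compat. rewrite S_INR. replace (1 - / (INR m + 1))%R
      with (INR m / (INR m + 1))%R by (field; lra). apply Rdiv_lt_0_compat; lra. }
rewrite fact_simpl, NC_mul, RtoC_inv by lra.
assert (N1 : NC (S m) <> 0) by (apply NC_neq0; lia).
assert (N2 := not_npint_neq z (S m) Hz). assert (N3 := poch_neq0 z (S m) Hz).
field. repeat split; auto. intros E; apply N2; rewrite <- E; ring.
Qed.

(** The operator [lim] is specified only on Cauchy filters, so a limit must be exhibited first in
    order to identify [Gamma z]. *)
Lemma Gamma_eq_lim (z l : C) : cv (Gamma_seq z) l -> Gamma z = l.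
Proof.
intros H. apply cv_unique with (2 := H). apply cv_filterlim in H. apply cv_filterlim.
apply (proj2 (filterlim_locally (U := C_UniformSpace) (Gamma_seq z) (Gamma z))).
intros eps.
apply (@complete_cauchy C_CompleteNormedModule (filtermap (Gamma_seq z) eventually)).
- apply filtermap_proper_filter, eventually_filter.
- intros e. exists l.
  exact (proj1 (filterlim_locally (U := C_UniformSpace) (Gamma_seq z) l) H e).
Qed.

(** Numerator [Y] and denominator [X] of the step ratio differ by O(1/n^2), so both Y/X and X/Y are
    1 + O(1/n^2), and the two infinite products converge. *)
Lemma cv_Gamma (z : C) : not_npint z -> cv (Gamma_seq z) (Gamma z) /\ Gamma z <> 0.
Proof.
intros Hz. destruct (cpowR_second_order z) as [K [PK HK]].
set (v := fun n : nat => (/ INR (S n))%R).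
assert (Hv : is_lim_seq v 0).
{ apply (is_lim_seq_incr_1 (fun n => / INR n)%R 0).
  apply (is_lim_seq_inv INR p_infty); [apply is_lim_seq_INR | discriminate]. }
set (X := fun n => 1 + z * RtoC (v n)). set (Y := fun n => cpowR (/ (1 - v n)) z).
assert (CX : cv X 1).
{ assert (Cv : cv (fun n => RtoC (v n)) 0).
  { apply is_lim_seq_ext with v; [|exact Hv]. intros n.
    replace (RtoC (v n) - 0) with (RtoC (v n)) by ring. rewrite Cmod_R, Rabs_pos_eq; auto.
    left; apply Rinv_0_lt_compat, lt_0_INR; lia. }
  assert (T := cv_plus _ _ _ _ (cv_const 1) (cv_scal _ _ z Cv)).
  replace (1 + z * 0) with (RtoC 1) in T by ring. exact T. }
assert (Vb : forall n, (1 <= n)%nat -> (0 <= v n <= / 2)%R).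
{ intros n Hn. unfold v. rewrite S_INR. apply le_INR in Hn. simpl in Hn. split.
  - left; apply Rinv_0_lt_compat; lra.
  - apply Rinv_le_contravar; lra. }
assert (XY : forall n, (1 <= n)%nat -> (Cmod (Y n - X n) <= K * v n ^ 2)%R).
{ intros n Hn. now apply HK, Vb. }
assert (CY : cv Y 1).
{ assert (T : cv (fun n => Y n - X n) 0).
  { apply cv_le with (fun n => K * (v n * v n))%R.
    - exists 1%nat; intros n Hn. replace (Y n - X n - 0) with (Y n - X n) by ring.
      eapply Rle_trans; [now apply XY|]. simpl. lra.
    - apply is_lim_seq_scal0. generalize (is_lim_seq_mult' _ _ _ _ Hv Hv).
      now rewrite Rmult_0_l. }
  assert (T' := cv_plus _ _ _ _ T CX). replace (0 + 1) with (RtoC 1) in T' by ring.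
  apply cv_ext with (2 := T'). intros n; ring. }
assert (half : forall Z : nat -> C, cv Z 1 -> exists N, forall n, (N <= n)%nat -> (/ 2 <= Cmod (Z n))%R).
{ intros Z HZ. assert (T := cv_Cmod _ _ HZ). rewrite Cmod_1 in T. apply is_lim_seq_spec in T.
  assert (P : 0 < / 2) by lra. destruct (T (mkposreal _ P)) as [N HN]. exists N; intros n Hn.
  specialize (HN n Hn). simpl in HN. apply Rabs_def2 in HN. lra. }
destruct (half X CX) as [N1 HX], (half Y CY) as [N2 HY].
(* The successor ensures [1 <= n], hence [v n <= / 2], as well as both lower bounds. *)
set (N := S (N1 + N2)).
set (g := fun n => (2 * K * v (S (n + N)) ^ 2)%R).
assert (Hg : ex_series g).
{ apply (ex_series_scal (V := R_NormedModule) (2 * K)%R).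
  assert (T := proj1 (ex_series_incr_n _ (S N)) ex_series_inv_sqr).
  apply ex_series_ext with (2 := T). intros n. unfold v. do 4 f_equal. lia. }
assert (quot : forall Z W : nat -> C, (forall n, (N <= n)%nat -> (/ 2 <= Cmod (W n))%R) ->
  (forall n, (N <= n)%nat -> (Cmod (Z n - W n) <= K * v n ^ 2)%R) ->
  forall n, (N <= n)%nat -> (Cmod (Z n / W n - 1) <= 2 * K * v n ^ 2)%R).
{ intros Z W HW HZ n Hn. specialize (HW n Hn). specialize (HZ n Hn).
  assert (NW : W n <> 0) by (apply Cmod_gt_0; lra).
  replace (Z n / W n - 1) with ((Z n - W n) / W n) by (field; exact NW).
  rewrite Cmod_div by exact NW. apply Rle_div_l; [lra|].
  assert (P := Rmult_le_pos _ _ PK (pow2_ge_0 (v n))).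
  assert (P' := Rmult_le_compat_l _ _ _ P HW). lra. }
assert (XYN : forall n, (N <= n)%nat -> (Cmod (Y n - X n) <= K * v n ^ 2)%R).
{ intros n Hn; apply XY; unfold N in Hn; lia. }
assert (YXN : forall n, (N <= n)%nat -> (Cmod (X n - Y n) <= K * v n ^ 2)%R).
{ intros n Hn. replace (X n - Y n) with (- (Y n - X n)) by ring. rewrite Cmod_opp.
  now apply XYN. }
assert (HXN : forall n, (N <= n)%nat -> (/ 2 <= Cmod (X n))%R).
{ intros n Hn; apply HX; unfold N in Hn; lia. }
assert (HYN : forall n, (N <= n)%nat -> (/ 2 <= Cmod (Y n))%R).
{ intros n Hn; apply HY; unfold N in Hn; lia. }
assert (NX : forall n, (N <= n)%nat -> X n <> 0).
{ intros n Hn. apply Cmod_gt_0. generalize (HXN n Hn); lra. }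
assert (NY : forall n, (N <= n)%nat -> Y n <> 0).
{ intros n Hn. apply Cmod_gt_0. generalize (HYN n Hn); lra. }
set (G := fun n => Gamma_seq z (n + S N)).
assert (GN : forall n, G n <> 0).
{ intros n. unfold G, Gamma_seq. apply Cmult_neq_0; [apply Cmult_neq_0|].
  - apply fact_C_neq0.
  - apply cpowR_neq0.
  - intros E. assert (T := Cinv_r (poch z (S (n + S N))) (poch_neq0 z _ Hz)).
    rewrite E, Cmult_0_r in T. now apply C1_nz. }
assert (GS : forall n, G (S n) = G n * (Y (S (n + N)) / X (S (n + N)))).
{ intros n. unfold G. replace (S n + S N)%nat with (S (S (n + N))) by lia.
  replace (n + S N)%nat with (S (n + N)) by lia. now apply Gamma_seq_S. }
destruct (ex_cv_product G (fun n => Y (S (n + N)) / X (S (n + N)) - 1) g) with (3 := Hg)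
  as [l Hl].
{ intros n. rewrite GS. f_equal. ring. }
{ intros n. apply (quot Y X); auto; lia. }
(* Convergence of the reciprocals gives [l * l' = 1], which is how [Gamma z <> 0] is obtained. *)
destruct (ex_cv_product (fun n => / G n) (fun n => X (S (n + N)) / Y (S (n + N)) - 1) g)
  with (3 := Hg) as [l' Hl'].
{ intros n. rewrite GS. field. repeat split; auto.
  - apply NY; lia.
  - apply NX; lia. }
{ intros n. apply (quot X Y); auto; lia. }
assert (El : l * l' = 1).
{ apply (cv_unique (fun n => G n * / G n)); [now apply cv_mult|].
  apply cv_ext with (2 := cv_const 1). intros n. symmetry. now apply Cinv_r. }
apply (proj2 (cv_incr _ _ (S N))) in Hl.
rewrite (Gamma_eq_lim z l Hl). split; [exact Hl|]. now apply Cmult_1_neq0 with l'.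
Qed.

Lemma Cinv_0 : / (RtoC 0) = 0.
Proof. unfold Cinv, RtoC; simpl. f_equal; unfold Rdiv; ring. Qed.

Lemma poch_npint (k n : nat) : (k < n)%nat -> poch (- NC k) n = 0.
Proof.
intros H. replace n with (S k + (n - S k))%nat by lia. rewrite poch_add. simpl. ring.
Qed.

(* Because [/ 0 = 0], [/ Gamma] is the entire reciprocal Gamma function, poles included. *)
Lemma Gamma_npint (k : nat) : Gamma (- NC k) = 0.
Proof.
apply Gamma_eq_lim. apply cv_ext_loc with (2 := cv_const 0).
exists k; intros n Hn. unfold Gamma_seq. rewrite poch_npint by lia.
unfold Cdiv. rewrite Cinv_0. ring.
Qed.

Lemma npint_dec (z : C) : not_npint z \/ exists k, z = - NC k.
Proof.
destruct (classic (not_npint z)) as [H|H]; [now left|right].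
apply not_all_not_ex. exact H.
Qed.

(** Gauss' limit inverted. In this form it also holds at the poles, where the Pochhammer factor is
    eventually 0. *)
Lemma cv_rGamma (z : C) :
  cv (fun n => poch z (S n) / (NC (fact n) * cpowR (INR n) z)) (/ Gamma z).
Proof.
destruct (npint_dec z) as [Hz|[k ->]].
- destruct (cv_Gamma z Hz) as [H HG]. apply cv_ext with (2 := cv_inv _ _ HG H).
  intros n. unfold Gamma_seq. assert (Np := poch_neq0 z (S n) Hz). field.
  repeat split; auto using fact_C_neq0, cpowR_neq0.
- rewrite Gamma_npint, Cinv_0. apply cv_ext_loc with (2 := cv_const 0).
  exists k; intros n Hn. rewrite poch_npint by lia. unfold Cdiv; ring.
Qed.

(** With m = n + 1, the Gauss terms of the two sides differ by the factor (z + m + 1)/m, which tends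
    to 1. No case distinction at the poles is required. *)
Lemma rGamma_rec (z : C) : / Gamma z = z * / Gamma (z + 1).
Proof.
assert (H1 := proj1 (cv_incr _ _ 1) (cv_rGamma z)).
assert (H2 := proj1 (cv_incr _ _ 1) (cv_scal _ _ z (cv_rGamma (z + 1)))).
assert (H3 := cv_mult _ _ _ _ H1 (cv_ratio_lin (z + 1 + 1))).
rewrite Cmult_1_r in H3. apply cv_unique with (1 := H3). apply cv_ext with (2 := H2).
intros n. cbv beta. rewrite Nat.add_1_r. set (m := S n).
assert (Hm : 0 < INR m) by (apply lt_0_INR; unfold m; lia).
rewrite cpowR_add, cpowR_1 by exact Hm.
replace (z * (poch (z + 1) (S m) / (NC (fact m) * (cpowR (INR m) z * NC m))))
  with ((z * poch (z + 1) (S m)) / (NC (fact m) * (cpowR (INR m) z * NC m))).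
- rewrite <- poch_shift.
  change (poch z (S (S m))) with (poch z (S m) * (z + NC (S m))).
  replace (NC (S m)) with (NC n + 1 + 1) by (unfold m; rewrite !NC_S; ring).
  unfold m at 4. rewrite (NC_S n). field.
  repeat split; auto using fact_C_neq0, cpowR_neq0, NC_S_neq0.
- field. repeat split; auto using fact_C_neq0, cpowR_neq0. apply NC_neq0; unfold m; lia.
Qed.

Lemma Gamma_rec (z : C) : not_npint z -> Gamma (z + 1) = z * Gamma z.
Proof.
intros Hz. assert (H := rGamma_rec z).
assert (N1 := proj2 (cv_Gamma z Hz)).
assert (N2 := proj2 (cv_Gamma _ (not_npint_add z 1 Hz))). change (NC 1) with (RtoC 1) in N2.
assert (N0 := not_npint_neq z 0 Hz). change (NC 0) with (RtoC 0) in N0.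
rewrite Cplus_0_r in N0.
replace (Gamma (z + 1)) with (/ Gamma z * Gamma z * Gamma (z + 1)) by (field; exact N1).
rewrite H. field. exact N2.
Qed.

Lemma rGamma_poch (c : C) (n : nat) : / Gamma c = poch c n * / Gamma (c + NC n).
Proof.
induction n as [|n IH]; [simpl; rewrite Cplus_0_r; ring|].
rewrite IH, (rGamma_rec (c + NC n)), NC_S. simpl poch.
replace (c + NC n + 1) with (c + (NC n + 1)) by ring. ring.
Qed.

(** * Gauss functions at 1/2 *)

Lemma subexp_rGamma (c : C) : subexp (fun n => NC (fact n) * / Gamma (c + NC n)).
Proof.
apply subexp_ratio with (1 := cv_ratio_lin_inv c).
destruct (eventually_add_neq0 c) as [N HN]. exists N; intros n Hn.
rewrite (rGamma_rec (c + NC n)), fact_C_S, NC_S.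
replace (c + NC n + 1) with (c + (NC n + 1)) by ring.
set (g := / Gamma _). field. now apply HN.
Qed.

Lemma subexp_NC : subexp (fun n => NC n).
Proof.
apply subexp_ratio with (1 := cv_ratio_lin_inv 0). exists 1%nat; intros n Hn.
rewrite NC_S, Cplus_0_l. field. apply NC_neq0; lia.
Qed.

(* [hyp a b c] is [2F1(a, b; c; 1/2) / Gamma c], which makes sense for every [c]. *)
Definition hyp_term (a b c : C) (n : nat) : C :=
  poch a n * poch b n / NC (fact n) * / Gamma (c + NC n) * RtoC (/ 2) ^ n.

Definition hyp (a b c : C) : C := csum_inf (hyp_term a b c).

Lemma subexp_hyp (a b c : C) :
  subexp (fun n => poch a n * poch b n / NC (fact n) * / Gamma (c + NC n)).
Proof.
apply subexp_ext with (2 := subexp_mult _ _ (subexp_mult _ _ (subexp_poch_fact a)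
  (subexp_poch_fact b)) (subexp_rGamma c)).
intros n. set (g := / Gamma _). field. apply fact_C_neq0.
Qed.

Lemma half_range : (0 <= / 2 < 1)%R.
Proof. lra. Qed.

Lemma sums_hyp (a b c : C) : sums (hyp_term a b c) (hyp a b c).
Proof.
apply csum_inf_correct. exact (ex_sums_subexp _ _ (subexp_hyp a b c) half_range).
Qed.

Lemma RtoC_half : RtoC (/ 2) = / 2.
Proof. rewrite RtoC_inv by lra. reflexivity. Qed.

(** From (b-1)_n - (b)_n = -n (b)_(n-1): lowering [b] changes term n by a multiple of data at index
    n - 1. The argument 1/2 left over from this index shift gives the factor 2. *)
Lemma hyp_contiguous_lower (a b c : C) :
  2 * hyp a (b - 1) c = hyp a b c + (c - a) * hyp a b (c + 1).
Proof.
set (X := fun n => match n with O => RtoC 0 | S k =>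
  / 2 * ((c - a) * hyp_term a b (c + 1) k - hyp_term a b c k) end).
assert (HX : sums X (/ 2 * ((c - a) * hyp a b (c + 1) - hyp a b c))).
{ replace (/ 2 * ((c - a) * hyp a b (c + 1) - hyp a b c))
    with (X 0%nat + / 2 * ((c - a) * hyp a b (c + 1) - hyp a b c)) by (simpl; ring).
  apply sums_shift. simpl. apply sums_scal, sums_minus; [apply sums_scal|]; apply sums_hyp. }
assert (H := sums_plus _ _ _ _ (sums_hyp a b c) HX).
assert (E : forall n, hyp_term a b c n + X n = hyp_term a (b - 1) c n).
{ intros [|k]; unfold X, hyp_term.
  + simpl. ring.
  + rewrite (poch_shift (b - 1)). replace (b - 1 + 1) with b by ring.
    rewrite (rGamma_rec (c + NC k)). replace (c + 1 + NC k) with (c + NC k + 1) by ring.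
    rewrite NC_S. replace (c + (NC k + 1)) with (c + NC k + 1) by ring.
    simpl poch. rewrite fact_C_S. simpl Cpow. rewrite RtoC_half.
    set (g := / Gamma _). set (h := (/ 2) ^ k). field.
    split; [apply fact_C_neq0 | apply NC_S_neq0]. }
rewrite (sums_unique _ _ _ (sums_hyp a (b - 1) c) (sums_ext _ _ _ E H)). field.
Qed.

(** True term by term, from a (a+1)_n = (a)_n (a+n) and a + n = (c + n) - (c - a). *)
Lemma hyp_contiguous_raise (a b c : C) :
  a * hyp (a + 1) b (c + 1) = hyp a b c - (c - a) * hyp a b (c + 1).
Proof.
assert (H := sums_minus _ _ _ _ (sums_hyp a b c) (sums_scal _ _ (c - a) (sums_hyp a b (c + 1)))).
apply sums_unique with (2 := H).
apply sums_ext with (2 := sums_scal _ _ a (sums_hyp (a + 1) b (c + 1))).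
intros n. unfold hyp_term. rewrite (rGamma_rec (c + NC n)).
replace (c + 1 + NC n) with (c + NC n + 1) by ring.
assert (E : a * poch (a + 1) n = poch a n * (a + NC n)) by (symmetry; apply (poch_shift a n)).
set (g := / Gamma _). unfold Cdiv.
transitivity (a * poch (a + 1) n * poch b n * / NC (fact n) * g * RtoC (/ 2) ^ n); [ring|].
rewrite E. ring.
Qed.

(* Telescoping with [Y n = 2 n (b)_n (1-b)_n / (n! 2^n Gamma (c + n + 1))]. *)
Lemma hyp_two_step (b c : C) :
  hyp b (1 - b) c = (c + b) * (c + 1 - b) * hyp b (1 - b) (c + 2).
Proof.
set (Y := fun n => 2 * (NC n * (poch b n * poch (1 - b) n / NC (fact n)
  * / Gamma (c + 1 + NC n)) * RtoC (/ 2) ^ n)).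
assert (exY : exists l, sums Y l).
{ destruct (ex_sums_subexp _ (/ 2) (subexp_mult _ _ subexp_NC (subexp_hyp b (1 - b) (c + 1)))
    half_range) as [l Hl]. exists (2 * l). exact (sums_scal _ _ 2 Hl). }
destruct exY as [l Hl].
assert (Hl' : sums (fun n => Y (S n)) l).
{ apply (proj2 (sums_shift Y l)). replace (Y 0%nat + l) with l; [exact Hl|].
  unfold Y; simpl. ring. }
assert (H1 := sums_minus _ _ _ _ Hl Hl').
assert (H2 := sums_minus _ _ _ _ (sums_hyp b (1 - b) c)
  (sums_scal _ _ ((c + b) * (c + 1 - b)) (sums_hyp b (1 - b) (c + 2)))).
apply Cminus_eq0. replace (RtoC 0) with (l - l) by ring.
apply sums_unique with (1 := H2). apply sums_ext with (2 := H1).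
intros n. unfold Y, hyp_term.
rewrite (rGamma_rec (c + NC n)), (rGamma_rec (c + 1 + NC n)), NC_S.
replace (c + NC n + 1) with (c + 1 + NC n) by ring.
rewrite (rGamma_rec (c + 1 + NC n)).
replace (c + 1 + NC n + 1) with (c + 2 + NC n) by ring.
replace (c + 1 + (NC n + 1)) with (c + 2 + NC n) by ring.
simpl poch. rewrite fact_C_S. simpl Cpow. rewrite RtoC_half.
set (g := / Gamma _). set (h := (/ 2) ^ n). field.
split; [apply fact_C_neq0 | apply NC_S_neq0].
Qed.

(** * Bailey's evaluation, the case i = 0 *)

Lemma cv_inv_lin (a : C) : cv (fun n => / (a + NC n)) 0.
Proof.
assert (H := cv_mult _ _ _ _ cv_inv_S (cv_ratio_lin_inv a)). rewrite Cmult_0_l in H.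
destruct (eventually_add_neq0 a) as [N HN].
apply cv_ext_loc with (2 := H). exists N; intros n Hn. field.
split; auto using NC_S_neq0.
Qed.

Lemma eventually_double : filterlim (fun n => (2 * n)%nat) eventually eventually.
Proof. apply eventually_subseq. intros n; lia. Qed.

Lemma cv_inv_poch_shift (c : C) (n : nat) : not_npint c ->
  cv (fun N => / poch (c + NC N) n) (match n with O => 1 | S _ => 0 end).
Proof.
intros Hc.
assert (Hs : forall N, not_npint (c + NC N)) by (intros; now apply not_npint_add).
induction n as [|n IH].
- apply cv_ext with (2 := cv_const 1). intros N; simpl. field.
- assert (H := cv_mult _ _ _ _ IH (cv_inv_lin (c + NC n))). rewrite Cmult_0_r in H.
  apply cv_ext with (2 := H). intros N. simpl.
  assert (N1 := poch_neq0 _ n (Hs N)). assert (N2 := not_npint_neq _ n (Hs N)).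
  replace (c + NC n + NC N) with (c + NC N + NC n) by ring. field. auto.
Qed.

Lemma Cmod_poch_ge (c : C) (n : nat) : (1 <= Re c)%R -> (INR (fact n) <= Cmod (poch c n))%R.
Proof.
intros Hc. induction n as [|n IH]; [simpl; rewrite Cmod_1; lra|].
rewrite fact_simpl, mult_INR, Rmult_comm. simpl poch. rewrite Cmod_mult.
apply Rmult_le_compat; auto using pos_INR.
eapply Rle_trans; [|apply re_le_Cmod]. rewrite S_INR. unfold Re in *; simpl.
eapply Rle_trans; [|apply Rle_abs]. lra.
Qed.

Lemma NC_2 : NC 2 = 2.
Proof. simpl. now f_equal. Qed.

Lemma not_npint_half (z : C) : not_npint z -> not_npint (z / 2).
Proof.
intros H k E. apply (H (2 * k)%nat). rewrite NC_mul, NC_2.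
replace z with (2 * (z / 2)) by field. rewrite E. ring.
Qed.

Lemma hyp_not_npint (a b c : C) : not_npint c ->
  sums (fun n => poch a n * poch b n / NC (fact n) / poch c n * RtoC (/ 2) ^ n)
    (Gamma c * hyp a b c).
Proof.
intros Hc. apply sums_ext with (2 := sums_scal _ _ (Gamma c) (sums_hyp a b c)).
intros n. unfold hyp_term.
assert (E := rGamma_poch c n). assert (N1 := proj2 (cv_Gamma c Hc)).
assert (N2 := poch_neq0 c n Hc).
replace (/ Gamma (c + NC n)) with (/ Gamma c / poch c n)
  by (rewrite E; set (g := / Gamma (c + NC n)); field; exact N2).
field. repeat split; auto using fact_C_neq0.
Qed.

(** As the lower parameter moves to the right only the term n = 0 survives. For real part at least 1
    the modulus of its Pochhammer symbol is at least n!, which gives a majorant independent of the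
    shift. *)
Lemma cv_hyp_shift (a b c : C) : not_npint c ->
  cv (fun N => Gamma (c + NC N) * hyp a b (c + NC N)) 1.
Proof.
intros Hc.
(* From [N0] on, the shifted parameter has real part at least 1, as [Cmod_poch_ge] requires. *)
destruct (INR_unbounded (1 - Re c)) as [N0 HN0].
apply (proj2 (cv_incr _ _ N0)).
apply (sums_dominated_convergence
  (fun N n => poch a n * poch b n / NC (fact n) / poch (c + NC (N + N0)) n * RtoC (/ 2) ^ n)
  (fun n => poch a n * poch b n / NC (fact n) * (match n with O => 1 | S _ => 0 end)
     * RtoC (/ 2) ^ n)
  (fun n => Cmod (poch a n / NC (fact n) * (poch b n / NC (fact n))) * (/ 2) ^ n)%R).
- intros N n. rewrite Cmod_scal_pow by lra.
  apply Rmult_le_compat_r; [apply pow_le; lra|].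
  replace (poch a n * poch b n / NC (fact n) / poch (c + NC (N + N0)) n)
    with (poch a n * poch b n / NC (fact n) * / poch (c + NC (N + N0)) n) by reflexivity.
  replace (poch a n / NC (fact n) * (poch b n / NC (fact n)))
    with (poch a n * poch b n / NC (fact n) * / NC (fact n)) by (field; apply fact_C_neq0).
  rewrite !(Cmod_mult (_ / _)). apply Rmult_le_compat_l; [apply Cmod_ge_0|].
  rewrite !Cmod_inv, Cmod_NC.
  + apply Rinv_le_contravar; [apply INR_fact_lt_0|]. apply Cmod_poch_ge.
    unfold Re in *; simpl. rewrite plus_INR. generalize (pos_INR N); lra.
  + apply fact_C_neq0.
  + now apply poch_neq0, not_npint_add.
- exact (ex_series_subexp _ _ (subexp_mult _ _ (subexp_poch_fact a) (subexp_poch_fact b)) half_range).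
- intros n. apply cv_mult; [|apply cv_const]. apply cv_mult; [apply cv_const|].
  apply (proj1 (cv_incr (fun N => / poch (c + NC N) n) _ N0)). now apply cv_inv_poch_shift.
- intros N. now apply hyp_not_npint, not_npint_add.
- apply (proj2 (cv_incr _ _ 0)). apply cv_ext with (2 := cv_const 1). intros n.
  rewrite Nat.add_0_r. induction n as [|n IH]; simpl; [field|]. rewrite <- IH. ring.
Qed.

(** The finite form of Legendre's duplication formula: even and odd factors are separated. *)
Lemma poch_duplication (z : C) (N : nat) :
  poch z (2 * N) = 4 ^ N * poch (z / 2) N * poch ((z + 1) / 2) N.
Proof.
induction N as [|N IH]; [simpl; ring|].
replace (2 * S N)%nat with (S (S (2 * N))) by lia. rewrite !poch_S, IH.
rewrite (NC_S (2 * N)), NC_mul, NC_2. simpl Cpow.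
replace (RtoC 4) with (RtoC 2 * RtoC 2) by (rewrite <- RtoC_mult; f_equal; ring).
field.
Qed.

(** With c = b + e, the j-th double step contributes (2b + e + 2j)(e + 1 + 2j). Duplication trades
    ((e+1)/2)_N for (e)_(2N) and (e/2)_N; the latter stays on the left, so nothing is divided by. *)
Lemma hyp_iterate (b e : C) (N : nat) : 
  poch (e / 2) N * hyp b (1 - b) (b + e)
  = poch (b + e / 2) N * poch e (2 * N) * hyp b (1 - b) (b + e + NC (2 * N)).
Proof.
assert (H : hyp b (1 - b) (b + e)
  = 4 ^ N * poch (b + e / 2) N * poch ((e + 1) / 2) N * hyp b (1 - b) (b + e + NC (2 * N))).
{ induction N as [|N IH]; [simpl; rewrite Cplus_0_r; ring|].
  rewrite IH, hyp_two_step. replace (2 * S N)%nat with (S (S (2 * N))) by lia.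
  replace (b + e + NC (S (S (2 * N)))) with (b + e + NC (2 * N) + 2)
    by (rewrite !NC_S; replace (RtoC 2) with (RtoC 1 + RtoC 1)
          by (rewrite <- RtoC_plus; f_equal; ring); ring).
  rewrite !poch_S, NC_mul, NC_2. simpl Cpow.
  replace (RtoC 4) with (RtoC 2 * RtoC 2) by (rewrite <- RtoC_mult; f_equal; ring).
  field. }
rewrite H at 1. rewrite poch_duplication. ring.
Qed.

Lemma cpowR_sub (a : R) (z w : C) : cpowR a (z - w) = cpowR a z / cpowR a w.
Proof.
unfold Cminus. rewrite cpowR_add. unfold Cdiv. f_equal.
assert (H := cpowR_opp a w). assert (N := cpowR_neq0 a w).
replace (cpowR a (- w)) with (cpowR a w * cpowR a (- w) / cpowR a w) by (field; exact N).
rewrite H. field; exact N.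
Qed.

(** Every Pochhammer symbol of [hyp_iterate] is part of a Gauss sequence, taken at M for the half
    arguments and at 2M for [e] and [c]; the shifted function tends to 1 after multiplication by its
    Gamma value. *)
Lemma hyp_bailey_regular (b e : C) : not_npint e -> not_npint (b + e) ->
  hyp b (1 - b) (b + e)
  = / cpowR 2 b * (Gamma (e / 2) / Gamma e) * / Gamma (b + e / 2).
Proof.
intros He Hc. set (c := b + e) in *.
assert (He2 := not_npint_half e He).
destruct (cv_Gamma e He) as [Le Ne]. destruct (cv_Gamma c Hc) as [Lc Nc].
destruct (cv_Gamma _ He2) as [Le2 Ne2].
assert (LR := cv_rGamma (b + e / 2)).
assert (Lre := cv_inv _ _ Ne Le).
apply (cv_subseq _ _ _ eventually_double) in Lre.
apply (cv_subseq _ _ _ eventually_double) in Lc.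
assert (LF := cv_hyp_shift b (1 - b) c Hc).
apply (cv_subseq _ _ _ eventually_double) in LF. apply (cv_incr _ _ 1) in LF.
(* At step M + 1 the symbols of [e] and [c] have 2M + 2 factors, one more than [Gamma_seq] at 2M;
   [Lq] handles the quotient (e + 2M + 1)/(c + 2M + 1) of the surplus factors. *)
assert (Lq := cv_mult _ _ _ _ (cv_ratio_lin (e + 1)) (cv_ratio_lin_inv (c + 1))).
apply (cv_subseq _ _ _ eventually_double) in Lq.
assert (L := cv_mult _ _ _ _ (cv_mult _ _ _ _ (cv_mult _ _ _ _ LR Le2)
  (cv_mult _ _ _ _ Lre Lc)) (cv_mult _ _ _ _ Lq LF)).
apply (cv_scal _ _ (/ Gamma c * / cpowR 2 b)) in L.
transitivity (/ Gamma c * / cpowR 2 b *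
  (/ Gamma (b + e / 2) * Gamma (e / 2) * (/ Gamma e * Gamma c) * (1 * 1 * 1))).
2: { set (g := / Gamma (b + e / 2)). field. repeat split; auto using cpowR_neq0. }
symmetry. apply cv_unique with (1 := L). apply cv_ext_loc with (2 := cv_const _).
exists 1%nat; intros M HM. cbv beta.
assert (PM : 0 < INR M) by (apply lt_0_INR; lia).
assert (I := hyp_iterate b e (M + 1)). fold c in I.
assert (G := rGamma_poch c (2 * (M + 1))).
set (F := hyp b (1 - b) (c + NC (2 * (M + 1)))) in *.
set (h := hyp b (1 - b) c) in *. unfold Gamma_seq.
(* The powers of M cancel among the four sequences, and (2M)^(c-e) leaves exactly 2^b. *)
assert (E2 : forall z, cpowR (INR (2 * M)) z = cpowR 2 z * cpowR (INR M) z).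
{ intros z. rewrite mult_INR, <- cpowR_mult_base by lra. f_equal. }
rewrite !E2.
assert (Np := poch_neq0 _ (M + 1) He2). assert (Npc := poch_neq0 _ (2 * (M + 1)) Hc).
assert (NG := proj2 (cv_Gamma _ (not_npint_add c (2 * (M + 1)) Hc))).
assert (EG : Gamma (c + NC (2 * (M + 1))) = poch c (2 * (M + 1)) * Gamma c).
{ replace (Gamma (c + NC (2 * (M + 1)))) with (/ Gamma c * Gamma c * Gamma (c + NC (2 * (M + 1))))
    by (field; exact Nc).
  rewrite G. field. exact NG. }
rewrite EG.
replace h with (poch (b + e / 2) (M + 1) * poch e (2 * (M + 1)) * F / poch (e / 2) (M + 1))
  by (rewrite <- I; field; exact Np).
replace (2 * (M + 1))%nat with (S (S (2 * M))) by lia. rewrite !(Nat.add_1_r M).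
change (poch e (S (S (2 * M)))) with (poch e (S (2 * M)) * (e + NC (S (2 * M)))).
change (poch c (S (S (2 * M)))) with (poch c (S (2 * M)) * (c + NC (S (2 * M)))).
rewrite (NC_S (2 * M)).
assert (N1 := poch_neq0 e (S (2 * M)) He). assert (N2 := poch_neq0 c (S (2 * M)) Hc).
assert (N3 := poch_neq0 _ (S M) He2). assert (N4 := NC_S_neq0 (2 * M)).
assert (N5 : c + 1 + NC (2 * M) <> 0).
{ assert (T := not_npint_neq c (S (2 * M)) Hc). rewrite NC_S in T.
  intros E; apply T; rewrite <- E; ring. }
(* All exponents are put in terms of [c], [e] and [e / 2], so that [cpowR_sub] splits the powers
   into atoms that [field] can cancel. *)
replace (e / 2) with (e - e / 2) in * by field.
replace (b + (e - e / 2)) with (c - e / 2) in * by (unfold c; field).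
replace b with (c - e) by (unfold c; ring).
rewrite !cpowR_sub.
set (p1 := poch (c - e / 2) (S M)). set (p2 := poch (e - e / 2) (S M)) in *.
replace (c + (NC (2 * M) + 1)) with (c + 1 + NC (2 * M)) by ring.
replace (e + (NC (2 * M) + 1)) with (e + 1 + NC (2 * M)) by ring.
field.
repeat split; auto using cpowR_neq0, fact_C_neq0.
Qed.

Lemma not_npint_succ (z : C) : not_npint z -> not_npint (z + 1).
Proof. exact (not_npint_add z 1). Qed.

(* Bailey's theorem for [2F1(b, 1-b; c; 1/2)]. *)
Lemma hyp_bailey (b e : C) : not_npint e ->
  cpowR 2 b * Gamma e * hyp b (1 - b) (b + e) = Gamma (e / 2) * / Gamma (b + e / 2).
Proof.
intros He.
(* The regularity of [b + e] is removed by going up: each double step replaces [e] by [e + 2], and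
   both sides obey the same recurrence even where Gamma (b + e) has a pole. *)
assert (H : forall K e, not_npint e -> not_npint (b + e + NC (2 * K)) ->
  hyp b (1 - b) (b + e) = / cpowR 2 b * (Gamma (e / 2) / Gamma e) * / Gamma (b + e / 2)).
{ clear e He. induction K as [|K IH]; intros e He Hc.
  - apply hyp_bailey_regular; [exact He|]. simpl in Hc. now rewrite Cplus_0_r in Hc.
  - assert (He1 := not_npint_succ e He). assert (He2 := not_npint_succ _ He1).
    assert (Eh : e + 1 + 1 = e + 2).
    { rewrite <- NC_2, !NC_S. change (NC 0) with (RtoC 0). ring. }
    assert (Ed : (e + 2) / 2 = e / 2 + 1) by field.
    rewrite hyp_two_step. replace (b + e + 2) with (b + (e + 2)) by ring.
    rewrite IH.
    + rewrite Ed. rewrite (rGamma_rec (b + e / 2)).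
      rewrite (Gamma_rec (e / 2)) by now apply not_npint_half.
      rewrite <- Eh, (Gamma_rec (e + 1)), (Gamma_rec e) by assumption.
      replace (b + (e / 2 + 1)) with (b + e / 2 + 1) by ring.
      assert (N0 := not_npint_neq e 0 He). change (NC 0) with (RtoC 0) in N0.
      rewrite Cplus_0_r in N0.
      assert (N1 := not_npint_neq e 1 He). change (NC 1) with (RtoC 1) in N1.
      set (g := / Gamma (b + e / 2 + 1)). field.
      repeat split; auto using cpowR_neq0. apply (proj2 (cv_Gamma e He)).
    + now rewrite <- Eh.
    + replace (b + (e + 2) + NC (2 * K)) with (b + e + NC (2 * S K)); [exact Hc|].
      rewrite !NC_mul, NC_2, NC_S. ring. }
assert (HK : exists K, not_npint (b + e + NC (2 * K))).
{ destruct (npint_dec (b + e)) as [Hc|[k Hk]].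
  - exists 0%nat. now apply not_npint_add.
  (* The shifted value is -k + 2(k + 1) = k + 2, a positive integer. *)
  - exists (S k). rewrite Hk. intros j E.
    assert (T : NC (2 * S k + j) = NC k).
    { rewrite NC_add. replace (NC (2 * S k)) with (- NC k + NC (2 * S k) + NC k) by ring.
      rewrite E. ring. }
    apply RtoC_inj, INR_eq in T. lia. }
destruct HK as [K HK]. rewrite (H K e He HK).
set (g := / Gamma (b + e / 2)). field.
split; [apply (proj2 (cv_Gamma e He)) | apply cpowR_neq0].
Qed.

(** * Induction on i through the contiguous relations *)

Lemma half_add_succ (e : C) (r : nat) : (e + NC (S r)) / 2 = (e + 1 + NC r) / 2.
Proof. rewrite NC_S. field. Qed.

(** Here c - a = e in [hyp_contiguous_lower], and e Gamma(e) = Gamma(e + 1) turns its second term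
    into the induction hypothesis at [e + 1]; the factor 2 joins the power of 2. *)
Lemma hyp_bailey_minus (i : nat) (b e : C) : not_npint e ->
  cpowR 2 (b + NC i) * Gamma e * hyp b (1 - b - NC i) (b + e)
  = bsum i (fun r => Gamma ((e + NC r) / 2) * / Gamma (b + (e + NC r) / 2)).
Proof.
revert e; induction i as [|i IH]; intros e He.
- replace (1 - b - NC 0) with (1 - b) by (simpl; ring).
  unfold bsum; simpl. rewrite !Cplus_0_r.
  rewrite (hyp_bailey b e He). ring.
- rewrite bsum_S, <- (IH e He).
  rewrite (bsum_ext i (fun r => Gamma ((e + NC (S r)) / 2) * _)
    (fun r => Gamma ((e + 1 + NC r) / 2) * / Gamma (b + (e + 1 + NC r) / 2))).
  2: intros r _; now rewrite half_add_succ.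
  rewrite <- (IH (e + 1) (not_npint_succ e He)).
  rewrite Gamma_rec by exact He.
  assert (C1 := hyp_contiguous_lower b (1 - b - NC i) (b + e)).
  replace (b + e - b) with e in C1 by ring.
  replace (b + (e + 1)) with (b + e + 1) by ring.
  rewrite NC_S. replace (1 - b - (NC i + 1)) with (1 - b - NC i - 1) by ring.
  replace (b + (NC i + 1)) with (b + NC i + 1) by ring.
  rewrite cpowR_add, cpowR_1 by lra.
  transitivity (cpowR 2 (b + NC i) * Gamma e * (2 * hyp b (1 - b - NC i - 1) (b + e))); [ring|].
  rewrite C1. ring.
Qed.

(** The same scheme with [hyp_contiguous_raise]: its factor a = b + i builds up [poch b i], and its
    minus sign makes the sum alternate. *)
Lemma hyp_bailey_plus (i : nat) (b e : C) : not_npint e ->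
  cpowR 2 b * Gamma e * poch b i * hyp (b + NC i) (1 - b) (b + NC i + e)
  = bsum i (fun r => (-(1)) ^ r * (Gamma ((e + NC r) / 2) * / Gamma (b + (e + NC r) / 2))).
Proof.
revert e; induction i as [|i IH]; intros e He.
- unfold bsum; simpl. rewrite !Cplus_0_r, Cmult_1_r, (hyp_bailey b e He). ring.
- rewrite bsum_S, <- (IH e He).
  rewrite (bsum_ext i (fun r => (-(1)) ^ (S r) * _)
    (fun r => (-(1)) * ((-(1)) ^ r *
       (Gamma ((e + 1 + NC r) / 2) * / Gamma (b + (e + 1 + NC r) / 2))))).
  2: intros r _; rewrite half_add_succ; simpl; ring.
  rewrite bsum_scal, <- (IH (e + 1) (not_npint_succ e He)).
  rewrite Gamma_rec by exact He.
  assert (C1 := hyp_contiguous_raise (b + NC i) (1 - b) (b + NC i + e)).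
  replace (b + NC i + e - (b + NC i)) with e in C1 by ring.
  replace (b + NC i + (e + 1)) with (b + NC i + e + 1) by ring.
  rewrite poch_S, NC_S. replace (b + (NC i + 1)) with (b + NC i + 1) by ring.
  replace (b + NC i + 1 + e) with (b + NC i + e + 1) by ring.
  transitivity (cpowR 2 b * Gamma e * poch b i *
    ((b + NC i) * hyp (b + NC i + 1) (1 - b) (b + NC i + e + 1))); [ring|].
  rewrite C1. ring.
Qed.

(** * Reduction of the Appell series *)

(** Convergence at 1 forces the radius to be at least 1. Abel's theorem serves when it equals 1;
    beyond that, continuity suffices. *)
Lemma Abel_seq (a : nat -> R) (x : nat -> R) (l : R) :
  is_pseries a 1 l -> (forall N, x N < 1)%R -> is_lim_seq x 1 ->
  is_lim_seq (fun N => PSeries a (x N)) l.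
Proof.
intros Ha Hx Lx. rewrite <- (is_pseries_unique a 1 l Ha).
assert (Ea : ex_pseries a 1) by (now exists l).
assert (R1 : Rbar_le 1 (CV_radius a)).
{ apply Rbar_not_lt_le. intros H. apply (CV_disk_outside a 1).
  - rewrite Rabs_R1. exact H.
  - apply ex_series_lim_0. now apply ex_pseries_R. }
apply Rbar_le_lt_or_eq_dec in R1. destruct R1 as [R1|R1].
- apply is_lim_seq_continuous; [|exact Lx]. apply PSeries_continuity. now rewrite Rabs_R1.
- assert (A := Abel a). rewrite <- R1 in A. cbn [real] in A.
  specialize (A Rlt_0_1 I Ea).
  apply filterlim_comp with (2 := A). intros P [d Hd].
  apply is_lim_seq_spec in Lx. destruct (Lx d) as [N HN]. exists N; intros n Hn.
  apply Hd; [apply HN, Hn | apply Hx].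
Qed.

Lemma Abel_sums (S : nat -> C) (L : C) (x : nat -> R) (f : nat -> C) :
  sums S L -> (forall N, x N < 1)%R -> is_lim_seq x 1 ->
  (forall N, sums (fun m => S m * RtoC (x N) ^ m) (f N)) -> cv f L.
Proof.
intros HS Hx Lx Hf.
assert (H1 : sums (fun m => S m * RtoC 1 ^ m) L).
{ apply sums_ext with (2 := HS). intros m. rewrite Cpow_1_l. ring. }
apply sums_pseries in H1. destruct H1 as [HR HI]. apply cv_components. split.
- apply is_lim_seq_ext with (2 := Abel_seq _ x _ HR Hx Lx). intros N.
  apply is_pseries_unique. apply (proj1 (sums_pseries S (x N) (f N)) (Hf N)).
- apply is_lim_seq_ext with (2 := Abel_seq _ x _ HI Hx Lx). intros N.
  apply is_pseries_unique. apply (proj1 (sums_pseries S (x N) (f N)) (Hf N)).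
Qed.

(** Separates arbitrarily slow growth in [m] from geometric decay in [n], so that row sums exist and
    are again subexponential in [m]. *)
Lemma row_bound (p r : nat -> C) (w : nat -> nat -> C) (rho : R) : subexp p -> subexp r ->
  (forall m n, Cmod (w m n) <= Cmod (p n) * Cmod (r (m + n)%nat) * (/ 2) ^ n)%R ->
  (1 < rho)%R -> exists M q : R,
  ((0 <= M /\ 0 <= q < 1) /\ forall m n, Cmod (w m n) <= M * rho ^ m * q ^ n)%R.
Proof.
(* The cap 5/4 makes s^2 / 2 at most 25/32, hence less than 1. *)
intros Hp Hr Hw Hrho. set (s := Rmin rho (5 / 4)).
assert (Hs : (1 < s /\ s <= rho /\ s <= 5 / 4)%R).
{ unfold s; repeat split; [apply Rmin_glb_lt; lra | apply Rmin_l | apply Rmin_r]. }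
destruct (Hp s) as [M [PM HM]]; [lra|]. destruct (Hr s) as [M' [PM' HM']]; [lra|].
exists (M * M')%R, (s * s * / 2)%R. repeat split.
- now apply Rmult_le_pos.
- nra.
- nra.
- intros m n. eapply Rle_trans; [apply Hw|].
  apply Rle_trans with ((M * s ^ n) * (M' * s ^ (m + n)) * (/ 2) ^ n)%R.
  + apply Rmult_le_compat_r; [apply pow_le; lra|].
    apply Rmult_le_compat; auto using Cmod_ge_0.
  + replace (M * s ^ n * (M' * s ^ (m + n)) * (/ 2) ^ n)%R
      with (M * M' * s ^ m * (s * s * / 2) ^ n)%R
      by (rewrite pow_add, !Rpow_mult_distr; ring).
    apply Rmult_le_compat_r; [apply pow_le; nra|].
    apply Rmult_le_compat_l; [now apply Rmult_le_pos|]. apply pow_incr; lra.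
Qed.

Lemma ex_row_sums (p r : nat -> C) (w : nat -> nat -> C) (m : nat) : subexp p -> subexp r ->
  (forall m n, Cmod (w m n) <= Cmod (p n) * Cmod (r (m + n)%nat) * (/ 2) ^ n)%R ->
  exists l, sums (w m) l.
Proof.
intros Hp Hr Hw.
destruct (row_bound p r w 2 Hp Hr Hw) as [M [q [[PM Hq] H]]]; [lra|].
apply ex_sums_dominated with (1 := H m). now apply ex_series_geom_scal.
Qed.

Lemma subexp_row_sums (p r : nat -> C) (w : nat -> nat -> C) (s : nat -> C) : subexp p -> subexp r ->
  (forall m n, Cmod (w m n) <= Cmod (p n) * Cmod (r (m + n)%nat) * (/ 2) ^ n)%R ->
  (forall m, sums (w m) (s m)) -> subexp s.
Proof.
intros Hp Hr Hw Hs rho Hrho. destruct (row_bound p r w rho Hp Hr Hw Hrho) as [M [q [[PM Hq] H]]].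
exists (M * / (1 - q))%R. split.
- apply Rmult_le_pos; [exact PM|]. left; apply Rinv_0_lt_compat; lra.
- intros m. apply (sums_Cmod_le (w m) (fun n => M * rho ^ m * q ^ n)%R); auto.
  replace (M * / (1 - q) * rho ^ m)%R with (M * rho ^ m * / (1 - q))%R by ring.
  apply (is_series_scal (V := R_NormedModule) (M * rho ^ m)%R).
  apply is_series_geom. rewrite Rabs_pos_eq; lra.
Qed.

Lemma fact_mul_le (m n : nat) : (INR (fact m) * INR (fact n) <= INR (fact (m + n)))%R.
Proof.
rewrite <- mult_INR. apply le_INR.
assert (H := binom_fact (m + n) m ltac:(lia)).
replace (m + n - m)%nat with n in H by lia.
assert (H0 := fact_neq_0 (m + n)). rewrite <- H in H0 |- *.
destruct (binom (m + n) m) as [|q]; [easy|]. apply Nat.le_add_r.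
Qed.

(** As rho decreases to 1 the product tends to 2u < 1. The factor 1 + rho is the binomial sum of the
    powers of rho on one antidiagonal. *)
Lemma exists_pfaff_rate (u : R) : (0 <= u < / 2)%R ->
  exists rho : R, (1 < rho /\ rho * u * (1 + rho) < 1)%R.
Proof.
intros Hu. exists (1 + (1 - 2 * u) / 4)%R. split; [lra|]. nra.
Qed.

Lemma binomial_majorant (k : nat) (x : R) (f : nat -> C) (M : R) :
  (forall m, Cmod (f m) <= M * x ^ m)%R -> (0 <= x)%R ->
  (sum_f_R0 (fun m => INR (binom k m) * Cmod (f m)) k <= M * (1 + x) ^ k)%R.
Proof.
intros Hf Hx.
assert (E : forall n g, csum n (fun m => RtoC (g m)) = RtoC (sum_f_R0 g n)).
{ induction n as [|n IH]; intros g; simpl; [reflexivity|]. now rewrite IH, RtoC_plus. }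
assert (B := bsum_pow k (RtoC x)). unfold bsum in B.
rewrite (csum_ext k _ (fun m => RtoC (INR (binom k m) * x ^ m))) in B
  by (intros; now rewrite RtoC_mult, RtoC_pow).
rewrite E, <- RtoC_plus, <- RtoC_pow in B. apply RtoC_inj in B. rewrite <- B.
rewrite scal_sum. apply sum_Rle. intros m _.
rewrite Rmult_assoc, (Rmult_comm _ M). apply Rmult_le_compat_l; [apply pos_INR | apply Hf].
Qed.

(* Pfaff's transformation for a power series [sum (-1)^m (a)_m/m! s_m x^m] with
   [x = u / (1 - u)]: the double expansion of [(1-u)^(-a-m)] converges absolutely
   exactly because [u < 1/2]. *)
Lemma pfaff_sums (a : C) (s : nat -> C) (u : R) : subexp s -> (0 <= u < / 2)%R ->
  exists f : C,
    sums (fun m => (-(1)) ^ m * (poch a m / NC (fact m)) * s m * RtoC (u / (1 - u)) ^ m) f /\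
    sums (fun k => poch a k / NC (fact k) * bsum k (fun m => (-(1)) ^ m * s m) * RtoC u ^ k)
      (cpowR (/ (1 - u)) a * f).
Proof.
intros Hs Hu.
set (A := fun m j => (-(1)) ^ m * s m * (poch a (m + j) / (NC (fact m) * NC (fact j)))
  * RtoC u ^ (m + j)).
destruct (exists_pfaff_rate u Hu) as [rho [Hrho Hq]].
destruct (Hs rho Hrho) as [M [PM HM]].
destruct (subexp_poch_fact a rho Hrho) as [M' [PM' HM']].
assert (EA : forall k m, (m <= k)%nat ->
  A m (k - m)%nat = poch a k / NC (fact k) * RtoC u ^ k * (NC (binom k m) * ((-(1)) ^ m * s m))).
{ intros k m Hm. unfold A. replace (m + (k - m))%nat with k by lia.
  rewrite (binom_C k m Hm). field. repeat split; apply fact_C_neq0. }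
destruct (sums_diagonal A (fun k => M' * M * (rho * u * (1 + rho)) ^ k)%R)
  as [row [L [Hrow [HL HD]]]].
{ intros k.
  rewrite (sum_eq _ (fun m => INR (binom k m) * Cmod (s m)
    * (Cmod (poch a k / NC (fact k)) * u ^ k))%R).
  - rewrite <- scal_sum.
    assert (B := binomial_majorant k rho s M HM ltac:(lra)).
    replace (M' * M * (rho * u * (1 + rho)) ^ k)%R
      with ((M' * rho ^ k) * u ^ k * (M * (1 + rho) ^ k))%R
      by (rewrite !Rpow_mult_distr; ring).
    apply Rmult_le_compat; auto.
    + apply Rmult_le_pos; [apply Cmod_ge_0 | apply pow_le; lra].
    + apply cond_pos_sum; intros; apply Rmult_le_pos; [apply pos_INR | apply Cmod_ge_0].
    + apply Rmult_le_compat_r; [apply pow_le; lra | apply HM'].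
  - intros m Hm. rewrite EA by exact Hm.
    rewrite Cmod_mult, Cmod_scal_pow, (Cmod_mult (NC _)), Cmod_NC, Cmod_mult, Cmod_pow, Cmod_m1, pow1
      by lra. ring. }
{ apply ex_series_geom_scal. split; [|exact Hq].
  apply Rmult_le_pos; [apply Rmult_le_pos|]; lra. }
set (P := cpowR (/ (1 - u)) a). assert (NP : P <> 0) by apply cpowR_neq0.
assert (Pu : (0 < / (1 - u))%R) by (apply Rinv_0_lt_compat; lra).
exists (/ P * L). split.
- apply sums_ext with (2 := sums_scal _ _ (/ P) HL). intros m.
  replace (row m) with ((-(1)) ^ m * s m * (poch a m / NC (fact m)) * RtoC u ^ m
    * cpowR (/ (1 - u)) (a + NC m)).
  + rewrite cpowR_add, cpowR_NC by exact Pu. fold P.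
    unfold Rdiv. rewrite RtoC_mult, Cpow_mult_l. field. split; auto using fact_C_neq0.
  + apply sums_unique with (2 := Hrow m).
    apply sums_ext with (2 := sums_scal _ _ _ (binomial_series (a + NC m) u ltac:(lra))).
    intros j. unfold A. rewrite poch_add, Cpow_add_r. field. split; apply fact_C_neq0.
- replace (P * (/ P * L)) with L by (field; exact NP).
  apply sums_ext with (2 := HD). intros k. rewrite (csum_ext k _ _ (EA k)), csum_scal.
  fold (bsum k (fun m => (-(1)) ^ m * s m)). ring.
Qed.

Lemma cv_RtoC_pow (u : nat -> R) (l : R) (n : nat) :
  is_lim_seq u l -> cv (fun N => RtoC (u N) ^ n) (RtoC l ^ n).
Proof.
intros H. induction n as [|n IH]; simpl; [apply cv_const|].
apply cv_mult; [|exact IH]. apply cv_components. split; [exact H|].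
apply is_lim_seq_const.
Qed.

Lemma cv_sums_half (v : nat -> C) (u : nat -> R) (s : nat -> C) (t : C) :
  subexp v -> (forall N, 0 <= u N <= / 2)%R -> is_lim_seq u (/ 2)%R ->
  (forall N, sums (fun n => v n * RtoC (u N) ^ n) (s N)) ->
  sums (fun n => v n * RtoC (/ 2) ^ n) t -> cv s t.
Proof.
intros Hv Hu Lu Hs Ht.
apply (sums_dominated_convergence (fun N n => v n * RtoC (u N) ^ n)
  (fun n => v n * RtoC (/ 2) ^ n) (fun n => Cmod (v n) * (/ 2) ^ n)%R); auto.
- intros N n. specialize (Hu N). rewrite Cmod_scal_pow by lra.
  apply Rmult_le_compat_l; [apply Cmod_ge_0 | apply pow_incr; lra].
- exact (ex_series_subexp _ _ Hv half_range).
- intros n. apply cv_scal. now apply cv_RtoC_pow.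
Qed.

(* Abel's theorem lets the Pfaff transformation reach the boundary point [x = 1]. *)
Lemma pfaff_sums_1 (a : C) (s : nat -> C) (L : C) :
  subexp s -> subexp (fun k => bsum k (fun m => (-(1)) ^ m * s m)) ->
  sums (fun m => (-(1)) ^ m * (poch a m / NC (fact m)) * s m) L ->
  sums (fun k => poch a k / NC (fact k) * bsum k (fun m => (-(1)) ^ m * s m) * RtoC (/ 2) ^ k)
    (cpowR 2 a * L).
Proof.
intros Ss ST HL. set (S := fun m => (-(1)) ^ m * (poch a m / NC (fact m)) * s m) in HL.
set (h := fun k => poch a k / NC (fact k) * bsum k (fun m => (-(1)) ^ m * s m)).
assert (Sh : subexp h) by (apply subexp_mult; [apply subexp_poch_fact | exact ST]).
destruct (ex_sums_subexp h (/ 2) Sh half_range) as [t Ht].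
(* The offset 2 keeps [x N] in [1/2, 1); u = x / (1 + x) inverts x = u / (1 - u). *)
set (x := fun N => (1 - / INR (2 + N))%R). set (u := fun N => (x N / (1 + x N))%R).
assert (Hx : forall N, (0 <= x N < 1)%R).
{ intros N. unfold x. assert (Q : 2 <= INR (2 + N)).
  { rewrite plus_INR. simpl. generalize (pos_INR N). lra. }
  assert (0 < / INR (2 + N))%R by (apply Rinv_0_lt_compat; lra).
  assert (/ INR (2 + N) <= / 2)%R by (apply Rinv_le_contravar; lra). lra. }
assert (Lx : is_lim_seq x 1).
{ replace (Finite 1) with (Finite (1 - 0)) by (f_equal; ring).
  apply is_lim_seq_minus'; [apply is_lim_seq_const|].
  assert (H := is_lim_seq_inv INR p_infty is_lim_seq_INR ltac:(discriminate)).
  apply (proj1 (is_lim_seq_incr_n (fun n => / INR n)%R 2 0)) in H.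
  apply is_lim_seq_ext with (2 := H). intros n. do 2 f_equal. lia. }
assert (Hu : forall N, (0 <= u N < / 2)%R).
{ intros N. specialize (Hx N). unfold u. split.
  - apply Rdiv_le_0_compat; lra.
  - apply Rlt_div_l; lra. }
assert (Lu : is_lim_seq u (/ 2)%R).
{ replace (/ 2)%R with (1 / (1 + 1))%R by field.
  apply is_lim_seq_div'; [exact Lx | |lra].
  apply is_lim_seq_plus'; [apply is_lim_seq_const | exact Lx]. }
assert (Eu : forall N, (u N / (1 - u N))%R = x N).
{ intros N. specialize (Hx N). unfold u. field. lra. }
assert (Hu' : forall N, (0 <= u N <= / 2)%R) by (intros N; generalize (Hu N); lra).
(* [pfaff_sums] only asserts that a sum exists for each [N]; [csum_inf] turns these sums into one
   sequence. *)
set (f := fun N => csum_inf (fun m => S m * RtoC (x N) ^ m)).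
assert (Hf : forall N, sums (fun m => S m * RtoC (x N) ^ m) (f N) /\
  sums (fun k => h k * RtoC (u N) ^ k) (cpowR (/ (1 - u N)) a * f N)).
{ intros N. destruct (pfaff_sums a s (u N) Ss (Hu N)) as [f' [H1 H2]].
  assert (H3 : sums (fun m => S m * RtoC (x N) ^ m) f').
  { apply sums_ext with (2 := H1). intros m. now rewrite Eu. }
  assert (H4 := csum_inf_correct _ (ex_intro _ _ H3)). fold (f N) in H4.
  rewrite (sums_unique _ _ _ H4 H3) in *. split; auto. }
assert (Lf : cv f L).
{ apply (Abel_sums S L x f HL); auto; [intros N; apply Hx | intros N; apply Hf]. }
assert (Lp : cv (fun N => cpowR (/ (1 - u N)) a) (cpowR 2 a)).
{ apply (cv_sums_half (fun n => poch a n / NC (fact n)) u _ _ (subexp_poch_fact a) Hu' Lu).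
  - intros N. apply binomial_series. generalize (Hu N); lra.
  - replace (cpowR 2 a) with (cpowR (/ (1 - / 2)) a) by (f_equal; field).
    apply binomial_series. lra. }
rewrite (cv_unique _ _ _ (cv_mult _ _ _ _ Lp Lf)
  (cv_sums_half h u _ t Sh Hu' Lu (fun N => proj2 (Hf N)) Ht)).
exact Ht.
Qed.

(** Since [rt] depends on k + n only and both indices carry the argument 1/2, each antidiagonal is a
    Chu-Vandermonde convolution. *)
Lemma sums_poch_convolution (a g : C) (rt T : nat -> C) (L : C) : subexp rt ->
  (forall k, sums (fun n => poch g n / NC (fact n) * rt (k + n)%nat * RtoC (/ 2) ^ n) (T k)) ->
  sums (fun k => poch a k / NC (fact k) * T k * RtoC (/ 2) ^ k) L ->
  sums (fun n => poch (a + g) n / NC (fact n) * rt n * RtoC (/ 2) ^ n) L.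
Proof.
intros Srt HT Hh.
set (wt := fun k n => poch g n / NC (fact n) * rt (k + n)%nat * RtoC (/ 2) ^ n) in HT.
set (A := fun k n => poch a k / NC (fact k) * RtoC (/ 2) ^ k * wt k n).
assert (Ea : forall N k, (k <= N)%nat -> A k (N - k)%nat
  = rt N * RtoC (/ 2) ^ N / NC (fact N) * (NC (binom N k) * (poch a k * poch g (N - k)))).
{ intros N k Hk. unfold A, wt. replace (k + (N - k))%nat with N by lia.
  rewrite (binom_C N k Hk). replace (RtoC (/ 2) ^ N) with (RtoC (/ 2) ^ k * RtoC (/ 2) ^ (N - k)).
  - field. repeat split; apply fact_C_neq0.
  - rewrite <- Cpow_add_r. f_equal. lia. }
(* On antidiagonal N the two Pochhammer quotients together grow at most like (5/4)^N, and so does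
   [rt]; the factor N + 1 of the majorant counts the terms. *)
set (q := (5 / 4 * (5 / 4) * / 2)%R). assert (Hq : (0 <= q < 1)%R) by (unfold q; lra).
destruct (subexp_poch_fact a (5 / 4)%R) as [M1 [PM1 HM1]]; [lra|].
destruct (subexp_poch_fact g (5 / 4)%R) as [M2 [PM2 HM2]]; [lra|].
destruct (Srt (5 / 4)%R) as [M3 [PM3 HM3]]; [lra|].
destruct (sums_diagonal A (fun N => M1 * M2 * M3 * (INR (1 + N) * q ^ N))%R)
  as [row [L' [Hrow [HL' HD]]]].
{ intros N.
  assert (PQ : forall m, (0 <= (5 / 4) ^ m)%R) by (intros; apply pow_le; lra).
  apply Rle_trans with (sum_f_R0 (fun _ => M1 * M2 * M3 * q ^ N)%R N).
  2: rewrite sum_cte; change (1 + N)%nat with (S N); right; ring.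
  apply sum_Rle. intros k Hk. unfold A, wt. replace (k + (N - k))%nat with N by lia.
  rewrite Cmod_mult, !Cmod_scal_pow, Cmod_mult by lra.
  replace (M1 * M2 * M3 * q ^ N)%R with
    (M1 * (5 / 4) ^ k * (/ 2) ^ k
     * (M2 * (5 / 4) ^ (N - k) * (M3 * (5 / 4) ^ N) * (/ 2) ^ (N - k)))%R.
  - repeat apply Rmult_le_compat; auto using Cmod_ge_0, Rmult_le_pos, pow_le;
      try (apply pow_le; lra); try apply Rle_refl;
      repeat apply Rmult_le_pos; try apply Cmod_ge_0; apply pow_le; lra.
  - assert (PW : forall y, (y ^ k * y ^ (N - k) = y ^ N)%R).
    { intros y. rewrite <- pow_add. f_equal. lia. }
    replace (q ^ N)%R with ((5 / 4) ^ k * (5 / 4) ^ (N - k) * (5 / 4) ^ N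
      * ((/ 2) ^ k * (/ 2) ^ (N - k)))%R by (rewrite !PW; unfold q; rewrite !Rpow_mult_distr; ring).
    ring. }
{ apply (ex_series_scal (V := R_NormedModule) (M1 * M2 * M3)%R).
  apply ex_series_ext with (fun N => Cmod (NC (1 + N)) * q ^ N)%R.
  - intros N. now rewrite Cmod_NC.
  - apply (ex_series_subexp (fun N => NC (1 + N))); [|exact Hq].
    (* Uses (2)_n / n! = n + 1. *)
    apply subexp_ext with (2 := subexp_poch_fact 2). intros n.
    induction n as [|n IH]; [simpl; field|].
    transitivity (poch 2 n / NC (fact n) * ((2 + NC n) / (NC n + 1))).
    + rewrite poch_S, fact_C_S. field. split; auto using fact_C_neq0, NC_S_neq0.
    + rewrite IH, !NC_add, (NC_S n). change (NC 1) with (RtoC 1).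
      replace (RtoC 2) with (RtoC 1 + RtoC 1) by (rewrite <- RtoC_plus; now f_equal).
      field. apply NC_S_neq0. }
assert (Erow : forall k, row k = poch a k / NC (fact k) * T k * RtoC (/ 2) ^ k).
{ intros k. apply sums_unique with (1 := Hrow k).
  replace (poch a k / NC (fact k) * T k * RtoC (/ 2) ^ k)
    with (poch a k / NC (fact k) * RtoC (/ 2) ^ k * T k) by ring.
  exact (sums_scal _ _ (poch a k / NC (fact k) * RtoC (/ 2) ^ k) (HT k)). }
rewrite (sums_unique _ _ _ Hh (sums_ext _ _ _ Erow HL')).
apply sums_ext with (2 := HD).
intros N. rewrite (csum_ext N _ _ (Ea N)), csum_scal.
fold (bsum N (fun k => poch a k * poch g (N - k))). rewrite bsum_poch_mul.
field. apply fact_C_neq0.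
Qed.

(** Valid for every [gam]; the special fourth parameter enters only afterwards, when the Gauss
    function at 1/2 has to be evaluated. *)
Lemma F3_sum (alpha eps gam beta : C) (S : nat -> C) (L : C) :
  not_npint beta ->
  (forall m, sums (F3_term alpha eps (beta - eps) gam beta (-1) (/ 2) m) (S m)) ->
  sums S L ->
  cpowR 2 alpha * L = Gamma beta * hyp (beta - eps) (alpha + gam) beta.
Proof.
intros Hb HS HL. set (b := beta - eps) in *.
set (p := fun n => poch gam n / NC (fact n) * (poch b n / NC (fact n))).
set (r := fun n => NC (fact n) / poch beta n).
assert (Sp : subexp p) by (apply subexp_mult; apply subexp_poch_fact).
assert (Sr : subexp r) by now apply subexp_fact_poch.
(* A row multiplied by m!, so that it factors into subexponential pieces and the inverse binomial
   weight m! n! / (m+n)!, which is at most 1; [s] divides m! out again. *)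
set (w := fun m n => p n * r (m + n)%nat * (NC (fact m) * NC (fact n) / NC (fact (m + n)))
  * RtoC (/ 2) ^ n).
assert (Hw : forall m n, (Cmod (w m n) <= Cmod (p n) * Cmod (r (m + n)%nat) * (/ 2) ^ n)%R).
{ intros m n. unfold w. rewrite Cmod_scal_pow by lra.
  rewrite (Cmod_mult (p n * _)), (Cmod_mult (p n)), Cmod_div, Cmod_mult, !Cmod_NC
    by apply fact_C_neq0.
  apply Rmult_le_compat_r; [apply pow_le; lra|].
  rewrite <- (Rmult_1_r (Cmod (p n) * _)) at 2.
  apply Rmult_le_compat_l; [apply Rmult_le_pos; apply Cmod_ge_0|].
  apply Rle_div_l; [apply INR_fact_lt_0|]. rewrite Rmult_1_l. apply fact_mul_le. }
set (rw := fun m => csum_inf (w m)).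
assert (Hrw : forall m, sums (w m) (rw m)).
{ intros m. apply csum_inf_correct. exact (ex_row_sums p r w m Sp Sr Hw). }
assert (Srw := subexp_row_sums p r w rw Sp Sr Hw Hrw).
set (s := fun m => poch eps m / NC (fact m) * rw m).
assert (Ss : subexp s) by (apply subexp_mult; [apply subexp_poch_fact | exact Srw]).
assert (Hs : forall m, sums (fun n => poch gam n / NC (fact n) * poch b n
  * (poch eps m / poch beta (m + n)) * RtoC (/ 2) ^ n) (s m)).
{ intros m. apply sums_ext with (2 := sums_scal _ _ (poch eps m / NC (fact m)) (Hrw m)).
  intros n. unfold w, p, r. field.
  repeat split; try apply fact_C_neq0. now apply poch_neq0. }
assert (ES : forall m, S m = (-(1)) ^ m * (poch alpha m / NC (fact m)) * s m).
{ intros m. apply sums_unique with (1 := HS m).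
  apply sums_ext with (2 := sums_scal _ _ ((-(1)) ^ m * (poch alpha m / NC (fact m))) (Hs m)).
  intros n. unfold F3_term. rewrite !cpown_Cpow, RtoC_half.
  replace (RtoC (-1)) with (-(1)) by (now rewrite <- RtoC_opp).
  unfold b. field. repeat split; try apply fact_C_neq0. now apply poch_neq0. }
set (T := fun k => bsum k (fun m => (-(1)) ^ m * s m)).
set (rt := fun n => poch b n / poch beta n).
assert (Srt : subexp rt).
{ apply subexp_ext with (2 := subexp_mult _ _ (subexp_poch_fact b) Sr). intros n.
  unfold rt, r. field. split; [now apply poch_neq0 | apply fact_C_neq0]. }
set (wt := fun k n => poch gam n / NC (fact n) * rt (k + n)%nat * RtoC (/ 2) ^ n).
assert (HT : forall k, sums (wt k) (T k)).
{ intros k. unfold T, bsum.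
  apply sums_ext with (2 := sums_csum k _ _
    (fun m _ => sums_scal _ _ (NC (binom k m)) (sums_scal _ _ ((-(1)) ^ m) (Hs m)))).
  intros n. assert (Hbn := not_npint_add beta n Hb).
  (* Splitting (beta)_(m+n) as (beta)_n (beta+n)_m isolates a sum over m to which Chu-Vandermonde
     applies, with lower parameter beta + n. *)
  transitivity (poch gam n / NC (fact n) * poch b n / poch beta n * RtoC (/ 2) ^ n
    * bsum k (fun m => (-(1)) ^ m * (poch eps m / poch (beta + NC n) m))).
  - unfold bsum. rewrite <- csum_scal. apply csum_ext; intros m _.
    rewrite (Nat.add_comm m n), poch_add. field.
    repeat split; try apply fact_C_neq0; now apply poch_neq0.
  - rewrite bsum_poch_ratio by exact Hbn. unfold wt, rt.
    rewrite (Nat.add_comm k n), !poch_add.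
    replace (beta + NC n - eps) with (b + NC n) by (unfold b; ring).
    field. repeat split; try apply fact_C_neq0; now apply poch_neq0. }
(* The definition of [T] as a binomial sum of [s] only suggests growth like 2^k, too fast for the
   point 1/2. The closed rows [wt] show that it is subexponential. *)
assert (ST : subexp T).
{ apply (subexp_row_sums (fun n => poch gam n / NC (fact n)) rt wt); auto.
  - apply subexp_poch_fact.
  - intros m n. unfold wt. rewrite Cmod_scal_pow, Cmod_mult by lra. apply Rle_refl. }
assert (Hh : sums (fun k => poch alpha k / NC (fact k) * T k * RtoC (/ 2) ^ k)
  (cpowR 2 alpha * L)).
{ apply pfaff_sums_1; auto. now apply sums_ext with (1 := ES). }
apply sums_unique with (1 := sums_poch_convolution _ _ _ _ _ Srt HT Hh).
apply sums_ext with (2 := hyp_not_npint b (alpha + gam) beta Hb).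
intros n. unfold rt. field. split; [now apply poch_neq0 | apply fact_C_neq0].
Qed.

(** * The two families of identities *)

Lemma cpowR_2_split (z w : C) : cpowR 2 (- (z + w)) * (cpowR 2 z * cpowR 2 w) = 1.
Proof. rewrite <- cpowR_add, Cmult_comm. apply cpowR_opp. Qed.

(** Bailey's sum is used with b = beta - eps - i and e = eps. The quotient Gamma(beta-eps-i) /
    Gamma(beta-eps) is the reciprocal of the [poch b i] in [hyp_bailey_plus]. *)
Lemma F3_half_plus (i : nat) (alpha beta eps : C) (S : nat -> C) (L : C) :
  not_npint beta -> not_npint (beta - eps - NC i) -> not_npint eps -> not_npint (beta - eps) ->
  (forall m, sums (F3_term alpha eps (beta - eps) (1 - alpha - beta + eps + NC i)
                     beta (-1) (/ 2) m) (S m)) ->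
  sums S L ->
  L = cpowR 2 (eps - alpha - beta + NC i) * Gamma (beta - eps - NC i) * Gamma beta
      / (Gamma eps * Gamma (beta - eps))
      * csum i (fun r => cpown (-1) r * NC (binom i r) * Gamma ((eps + NC r) / 2)
                 / Gamma (beta - NC i + (NC r - eps) / 2)).
Proof.
intros Hb Hbi He Hbe HS HL. assert (A := F3_sum _ _ _ _ _ _ Hb HS HL).
set (b := beta - eps - NC i) in *.
assert (B := hyp_bailey_plus i b eps He).
replace (alpha + (1 - alpha - beta + eps + NC i)) with (1 - b) in A by (unfold b; ring).
replace (b + NC i) with (beta - eps) in B by (unfold b; ring).
replace (beta - eps + eps) with beta in B by ring.
assert (Ne := proj2 (cv_Gamma eps He)). assert (Nb := proj2 (cv_Gamma b Hbi)).
assert (Nbe := proj2 (cv_Gamma _ Hbe)).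
assert (G : Gamma (beta - eps) = poch b i * Gamma b).
{ assert (T := rGamma_poch b i). replace (b + NC i) with (beta - eps) in T by (unfold b; ring).
  replace (Gamma (beta - eps)) with (/ Gamma b * Gamma b * Gamma (beta - eps)) by (now field).
  rewrite T. now field. }
assert (Np := poch_neq0 b i Hbi).
rewrite (csum_ext i _ (fun r => NC (binom i r) * ((-(1)) ^ r *
  (Gamma ((eps + NC r) / 2) * / Gamma (b + (eps + NC r) / 2))))).
- fold (bsum i (fun r => (-(1)) ^ r *
    (Gamma ((eps + NC r) / 2) * / Gamma (b + (eps + NC r) / 2)))).
  rewrite <- B, G.
  replace (eps - alpha - beta + NC i) with (- (alpha + b)) by (unfold b; ring).
  transitivity (cpowR 2 (- (alpha + b)) * cpowR 2 b * (cpowR 2 alpha * L)).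
  + transitivity (cpowR 2 (- (alpha + b)) * (cpowR 2 alpha * cpowR 2 b) * L); [|ring].
    rewrite cpowR_2_split. ring.
  + rewrite A. field. auto.
- intros r _. rewrite cpown_Cpow. replace (RtoC (-1)) with (-(1)) by (now rewrite <- RtoC_opp).
  replace (beta - NC i + (NC r - eps) / 2) with (b + (eps + NC r) / 2) by (unfold b; field).
  unfold Cdiv at 1. ring.
Qed.

(** Here b = beta - eps, so no Gamma quotient in [b] appears. *)
Lemma F3_half_minus (i : nat) (alpha beta eps : C) (S : nat -> C) (L : C) :
  not_npint beta -> not_npint eps ->
  (forall m, sums (F3_term alpha eps (beta - eps) (1 - alpha - beta + eps - NC i)
                     beta (-1) (/ 2) m) (S m)) ->
  sums S L ->
  L = cpowR 2 (eps - alpha - beta - NC i) * Gamma beta / Gamma eps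
      * csum i (fun r => NC (binom i r) * Gamma ((eps + NC r) / 2)
                 / Gamma (beta + (NC r - eps) / 2)).
Proof.
intros Hb He HS HL. assert (A := F3_sum _ _ _ _ _ _ Hb HS HL).
set (b := beta - eps) in *.
assert (B := hyp_bailey_minus i b eps He).
replace (alpha + (1 - alpha - beta + eps - NC i)) with (1 - b - NC i) in A by (unfold b; ring).
replace (b + eps) with beta in B by (unfold b; ring).
assert (Ne := proj2 (cv_Gamma eps He)).
rewrite (csum_ext i _ (fun r => NC (binom i r) *
  (Gamma ((eps + NC r) / 2) * / Gamma (b + (eps + NC r) / 2)))).
- fold (bsum i (fun r => Gamma ((eps + NC r) / 2) * / Gamma (b + (eps + NC r) / 2))).
  rewrite <- B.
  replace (eps - alpha - beta - NC i) with (- (alpha + (b + NC i))) by (unfold b; ring).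
  transitivity (cpowR 2 (- (alpha + (b + NC i))) * cpowR 2 (b + NC i) * (cpowR 2 alpha * L)).
  + transitivity (cpowR 2 (- (alpha + (b + NC i))) * (cpowR 2 alpha * cpowR 2 (b + NC i)) * L);
      [|ring].
    rewrite cpowR_2_split. ring.
  + rewrite A. field. exact Ne.
- intros r _.
  replace (beta + (NC r - eps) / 2) with (b + (eps + NC r) / 2) by (unfold b; field).
  unfold Cdiv at 1. ring.
Qed.

Theorem theorem10 (i : nat) (alpha beta eps : C) :
  (* first identity *)
  (not_npint beta ->
   dseries_converges
     (F3_term alpha eps (beta - eps) (1 - alpha - beta + eps + RtoC (INR i))
              beta (-1) (/ 2)) ->
   not_npint (beta - eps - RtoC (INR i)) -> not_npint eps ->
   not_npint (beta - eps) ->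
   (forall r : nat, (r <= i)%nat ->
      not_npint ((eps + RtoC (INR r)) / 2) /\
      not_npint (beta - RtoC (INR i) + (RtoC (INR r) - eps) / 2)) ->
   dseries_sum
     (F3_term alpha eps (beta - eps) (1 - alpha - beta + eps + RtoC (INR i))
              beta (-1) (/ 2))
     (cpowR 2 (eps - alpha - beta + RtoC (INR i))
      * Gamma (beta - eps - RtoC (INR i)) * Gamma beta
      / (Gamma eps * Gamma (beta - eps))
      * csum i (fun r => cpown (-1) r * RtoC (INR (binom i r))
                 * Gamma ((eps + RtoC (INR r)) / 2)
                 / Gamma (beta - RtoC (INR i) + (RtoC (INR r) - eps) / 2))))
  /\
  (* second identity *)
  (not_npint beta ->
   dseries_converges
     (F3_term alpha eps (beta - eps) (1 - alpha - beta + eps - RtoC (INR i))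
              beta (-1) (/ 2)) ->
   not_npint eps ->
   (forall r : nat, (r <= i)%nat ->
      not_npint ((eps + RtoC (INR r)) / 2) /\
      not_npint (beta + (RtoC (INR r) - eps) / 2)) ->
   dseries_sum
     (F3_term alpha eps (beta - eps) (1 - alpha - beta + eps - RtoC (INR i))
              beta (-1) (/ 2))
     (cpowR 2 (eps - alpha - beta - RtoC (INR i)) * Gamma beta / Gamma eps
      * csum i (fun r => RtoC (INR (binom i r))
                 * Gamma ((eps + RtoC (INR r)) / 2)
                 / Gamma (beta + (RtoC (INR r) - eps) / 2)))).
Proof.
split.
- intros Hb [_ Hc] Hbi He Hbe _ S HS. destruct (Hc S HS) as [L HL].
  rewrite <- (F3_half_plus i alpha beta eps S L); auto.
  + intros m. apply is_series_sums, HS.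
  + now apply is_series_sums.
- intros Hb [_ Hc] He _ S HS. destruct (Hc S HS) as [L HL].
  rewrite <- (F3_half_minus i alpha beta eps S L); auto.
  + intros m. apply is_series_sums, HS.
  + now apply is_series_sums.
Qed.
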